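(* Let $N\ge1$, $1<p<\infty$, $\alpha\ge0$. Let $a,b\in L^\infty_{loc}(\mathbb{R}^N)$ be nonnegative functions and let $f:[0,\infty)\to[0,\infty)$ be continuous with $f(t)>0$ for $t>0$. Assume that, for some $R_0>0$, $a,b>0$ almost everywhere on $\mathbb{R}^N\setminus B_{R_0}$, and that one of the following holds: (i) $\liminf_{t\to\infty}f(t)/t^q>0$ for some $q>p-1$, and either $(i_1)$ $\displaystyle\limsup_{R\to\infty}R^{\frac{pq}{\theta-q}}\int_{R\le|x|\le2R}a(x)^{\frac{\theta}{\theta-q}}\,dx<\infty$ for some $\theta\in(p-1,q)$, or $(i_2)$ $\alpha>p-1$ and $\displaystyle\limsup_{R\to\infty}R^{\frac{\alpha}{p-1-\alpha}}\int_{R\le|x|\le2R}b(x)^{\frac{p-1}{p-1-\alpha}}\,dx<\infty$; (ii) $\liminf_{t\to\infty}f(t)/t^q>0$ for some $q>0$, $\alpha>p-1$, and $$\limsup_{R\to\infty}R^{\frac{\alpha}{\theta-\alpha}}\int_{R\le|x|\le2R}\big[a(x)^{\frac{\theta}{p-1}-1}b(x)\big]^{\frac{p-1}{\theta-\alpha}}dx<\infty\quad\text{for some }\theta\in(p-1,\alpha).$$ Then the problem $$\Delta_p u\ge a(x)f(u)+b(x)|\nabla u|^\alpha\ \text{ in }\mathbb{R}^N,\qquad u\ge0\ \text{ on }\mathbb{R}^N,\qquad u(x)\to\infty\ \text{ as }|x|\to\infty,$$ has no solution in $C^1(\mathbb{R}^N)$.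
   Context: $\Delta_p u=\mathrm{div}(|\nabla u|^{p-2}\nabla u)$ is the $p$-Laplacian, and $B_R$ is the ball of radius $R$ centered at the origin of $\mathbb{R}^N$. The differential inequality is understood in the distributional sense: $\int|\nabla u|^{p-2}\nabla u\cdot\nabla\varphi\,dx+\int[a f(u)+b|\nabla u|^\alpha]\varphi\,dx\le0$ for all $0\le\varphi\in C_0^\infty(\mathbb{R}^N)$ (with $|\nabla u|^0=1$ when $\alpha=0$). *)

(* Defs.v *)
From HB Require Import structures.
From mathcomp Require Import all_boot all_order all_algebra.
From mathcomp Require Import all_classical all_reals all_analysis.

Set Implicit Arguments.
Unset Strict Implicit.
Unset Printing Implicit Defensive.

Import Order.TTheory GRing.Theory Num.Theory.
Import numFieldNormedType.Exports.

Local Open Scope classical_set_scope.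
Local Open Scope ring_scope.

(* R^n is 'rV[R]_n. Its norm `|x| in the library is the sup norm: it is used
   here only through the topology it induces. The Euclidean norm is enorm. *)

Definition rV_display : measure_display.
Proof. exact: default_measure_display. Qed.

(* The product sigma-algebra on R^n, generated by the coordinates. *)
Section measurable_rV.
Context {R : realType} (n : nat).

Local Notation coors := (fun (i : 'I_n) (x : 'rV[R]_n) => x ord0 i).

Let rV_set0 : g_sigma_preimage coors set0.
Proof. exact: sigma_algebra0. Qed.

Let rV_setC A : g_sigma_preimage coors A -> g_sigma_preimage coors (~` A).
Proof. exact: sigma_algebraC. Qed.

Let rV_bigcup (F : (set 'rV[R]_n)^nat) :
  (forall i, g_sigma_preimage coors (F i)) ->
  g_sigma_preimage coors (\bigcup_i F i).
Proof. exact: sigma_algebra_bigcup. Qed.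

HB.instance Definition _ := @isMeasurable.Build rV_display 'rV[R]_n
  (g_sigma_preimage coors) rV_set0 rV_setC rV_bigcup.

Lemma measurable_coord (i : 'I_n) :
  measurable_fun [set: 'rV[R]_n] (fun x => x ord0 i).
Proof.
move=> _ Y mY; rewrite setTI; apply: sub_sigma_algebra => /=.
rewrite -bigcup_seq/=; exists i => /=; first by rewrite mem_index_enum.
by exists Y => //; rewrite setTI.
Qed.

End measurable_rV.

Lemma measurable_fun_rVP {R : realType} (n : nat) d (T : measurableType d)
    (f : T -> 'rV[R]_n) :
  measurable_fun [set: T] f <->
  forall i, measurable_fun [set: T] (fun t => f t ord0 i).
Proof.
split=> [mf i|mf].
  exact: (measurableT_comp (measurable_coord i)).
move=> _ A mA; rewrite setTI.
have : g_sigma_preimage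
    (fun (i : 'I_n) => (fun x : 'rV[R]_n => x ord0 i) \o f) (f @^-1` A).
  by rewrite g_sigma_preimage_comp; exists A => //; rewrite setTI.
apply: smallest_sub; first exact: sigma_algebra_measurable.
clear A mA; case: n => [|m] in f mf *; first by rewrite big_ord0.
rewrite -bigcup_mkord_ord; apply: bigcup_sub => i Ii.
by move=> A [B mB <-]; exact: mf.
Qed.

(* From a measure mu on R^n to the product of Lebesgue measure and mu, carried
   to R^(1+n) by the identification of R x R^n with R^(1+n). *)
Section lebesgue_step.
Context {R : realType} (n : nat).
Variable mu : {sigma_finite_measure set 'rV[R]_n -> \bar R}.

Definition rV_cons (z : R * 'rV[R]_n) : 'rV[R]_n.+1 :=
  row_mx (z.1)%:M z.2.

Lemma rV_cons0 z : rV_cons z ord0 ord0 = z.1.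
Proof.
rewrite /rV_cons mxE; case: splitP => // j _.
by rewrite (ord1 j) mxE eqxx.
Qed.

Lemma rV_cons_lift z i : rV_cons z ord0 (lift ord0 i) = z.2 ord0 i.
Proof.
rewrite /rV_cons mxE; case: splitP => j /= ij.
  by have := ltn_ord j; rewrite -ij /bump leq0n add1n ltnS ltn0.
suff -> : j = i by [].
by apply/val_inj; case: ij.
Qed.

Lemma measurable_rV_cons : measurable_fun setT rV_cons.
Proof.
apply/measurable_fun_rVP => i; have [j ->|->] := unliftP ord0 i.
- under eq_fun do rewrite rV_cons_lift.
  by apply: (measurableT_comp (measurable_coord j)); exact: measurable_snd.
- under eq_fun do rewrite rV_cons0.
  exact: measurable_fst.
Qed.

Definition lebesgue_step : set 'rV[R]_n.+1 -> \bar R :=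
  pushforward (lebesgue_measure \x mu)%E rV_cons.

#[local] Hint Resolve measurable_rV_cons : core.

Let lebesgue_step0 : lebesgue_step set0 = 0%E.
Proof. exact: measure0. Qed.

Let lebesgue_step_ge0 A : (0 <= lebesgue_step A)%E.
Proof. exact: measure_ge0. Qed.

Let lebesgue_step_sigma_additive : semi_sigma_additive lebesgue_step.
Proof. exact: measure_semi_sigma_additive. Qed.

HB.instance Definition _ := isMeasure.Build _ _ _ lebesgue_step
  lebesgue_step0 lebesgue_step_ge0 lebesgue_step_sigma_additive.

Let lebesgue_step_sigma_finite : sigma_finite setT lebesgue_step.
Proof.
have /sigma_finiteP[F [FT Fnd Foo]] := sigma_finiteT (@lebesgue_measure R).
have /sigma_finiteP[G [GT Gnd Goo]] := sigma_finiteT mu.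
pose tl (x : 'rV[R]_n.+1) : 'rV[R]_n := \row_i x ord0 (lift ord0 i).
have mtl : measurable_fun setT tl.
  apply/measurable_fun_rVP => i; under eq_fun do rewrite mxE.
  exact: measurable_coord.
exists (fun k => [set x : 'rV[R]_n.+1 | F k (x ord0 ord0) /\ G k (tl x)]).
  apply/seteqP; split=> // x _.
  have [i _ Fi] : (\bigcup_i F i) (x ord0 ord0) by rewrite -FT.
  have [j _ Gj] : (\bigcup_i G i) (tl x) by rewrite -GT.
  exists (maxn i j) => //; split.
    by have /subsetPset FS := Fnd i _ (leq_maxl i j); exact: FS.
  by have /subsetPset GS := Gnd j _ (leq_maxr i j); exact: GS.
move=> k; have [mF Fk] := Foo k; have [mG Gk] := Goo k; split.
  apply: (@measurableI _ _ [set x : 'rV[R]_n.+1 | F k (x ord0 ord0)]).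
    rewrite -[X in measurable X]setTI; exact: measurable_coord.
  by rewrite -[X in measurable X]setTI; exact: mtl.
rewrite /lebesgue_step /pushforward.
suff -> : rV_cons @^-1`
    [set x : 'rV[R]_n.+1 | F k (x ord0 ord0) /\ G k (tl x)] = F k `*` G k.
  rewrite product_measure1E//.
  by rewrite lte_mul_pinfty// ge0_fin_numE.
by apply/seteqP; split=> -[y z] /=; rewrite rV_cons0 (_ : tl _ = z)//;
  apply/rowP => i; rewrite mxE rV_cons_lift.
Qed.

HB.instance Definition _ :=
  @Measure_isSigmaFinite.Build _ _ _ lebesgue_step lebesgue_step_sigma_finite.

End lebesgue_step.

(* Lebesgue measure on the product sigma-algebra of R^n: the n-fold product of
   the one-dimensional Lebesgue measure. *)
Fixpoint lebesgue_rV_borel {R : realType} (n : nat) :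
    {sigma_finite_measure set 'rV[R]_n -> \bar R} :=
  match n with
  | 0 => dirac (0 : 'rV[R]_0)
  | m.+1 => lebesgue_step (lebesgue_rV_borel m)
  end.

(* Its completion: measurability and negligibility with respect to lebesgue_rV
   are those of Lebesgue. The carrier of the measurable type is 'rV[R]_n. *)
Definition lebesgue_rV {R : realType} (n : nat) :
    set (caratheodory_type ((@lebesgue_rV_borel R n)^*)%mu) -> \bar R :=
  @completed_measure_extension _ _ R (lebesgue_rV_borel n).
Arguments lebesgue_rV {R} n A : rename.
HB.instance Definition _ (R : realType) (n : nat) :=
  Measure.on (@lebesgue_rV R n).

Notation lebesgue_measurable_fun f :=
  (measurable_fun
    [set: caratheodory_type ((@lebesgue_rV_borel _ _)^*)%mu] f).

Section euclidean.
Context {R : realType} {n : nat}.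
Implicit Types (x y : 'rV[R]_n) (u phi : 'rV[R]_n -> R).

Definition edot x y : R := \sum_(i < n) x ord0 i * y ord0 i.

Definition enorm x : R := Num.sqrt (edot x x).

Definition partial (i : 'I_n) u : 'rV[R]_n -> R :=
  fun x => 'D_(delta_mx ord0 i) u x.

Definition gradient u x : 'rV[R]_n := \row_i partial i u x.

Fixpoint of_class_C (k : nat) u : Prop :=
  match k with
  | 0 => continuous u
  | m.+1 => (forall x, differentiable u x) /\
            (forall i, of_class_C m (partial i u))
  end.

Definition test_function phi : Prop :=
  (forall k, of_class_C k phi) /\ compact (closure [set x | phi x != 0]).

Definition Linfty_loc (a : 'rV[R]_n -> R) : Prop :=
  lebesgue_measurable_fun a /\
  forall K : set 'rV[R]_n, compact K ->
    exists M : R, {ae lebesgue_rV n, forall x : 'rV[R]_n, K x -> `|a x| <= M}.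

(* |grad u|^(p-2) grad u; it vanishes where grad u does, also if p < 2, as
   0 `^ (p - 2) is then 0. *)
Definition p_flux (p : R) u x : 'rV[R]_n :=
  enorm (gradient u x) `^ (p - 2) *: gradient u x.

(* Delta_p u >= g in the sense of distributions. *)
Definition p_laplacian_ge (p : R) u (g : 'rV[R]_n -> R) : Prop :=
  forall phi, test_function phi -> (forall x, 0 <= phi x) ->
  (\int[lebesgue_rV n]_x (edot (p_flux p u x) (gradient phi x))%:E +
   \int[lebesgue_rV n]_x (g x * phi x)%:E <= 0)%E.

Definition annulus (r : R) : set 'rV[R]_n :=
  [set x | r <= enorm x /\ enorm x <= 2 * r].

End euclidean.

(* alpha = 0 is covered by 0 `^ 0 = 1. *)
Definition large_solution {R : realType} {n : nat} (p alpha : R)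
    (a b : 'rV[R]_n -> R) (f : R -> R) (u : 'rV[R]_n -> R) : Prop :=
  [/\ of_class_C 1 u,
      forall x, 0 <= u x,
      p_laplacian_ge p u
        (fun x => a x * f (u x) + b x * enorm (gradient u x) `^ alpha) &
      forall M : R, exists r : R, forall x, r <= enorm x -> M <= u x].

(* Main.v *)
Require Import Defs.
From mathcomp Require Import all_boot all_order all_algebra.
From mathcomp Require Import all_classical all_reals all_analysis.
From mathcomp Require Import ring lra measurable_realfun.

(** Suppose u is a solution, and test the inequality with H(u) psi_r, where
    H(t) = h(t) t^s with h nondecreasing, h = 0 for t <= k and h <= 1, and
    psi_r is a cutoff equal to 1 on B_r and to 0 off B_(2r), with
    |D psi_r| <= (C/r) psi_r^(1-1/m). With
    - s = q(theta-p+1)/(q-theta), Y = c a u^q H(u), 1 - tau = theta/q in case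
      (i_1), where the term H'(u) |Du|^p psi_r >= 0 absorbs the gradient,
    - s = q(theta-p+1)/(alpha-theta), Y = (c a u^q + b |Du|^alpha) H(u),
      1 - tau = theta/alpha in case (ii), of which (i_2) is the limit case
      theta = p - 1, s = 0,
    the right-hand side is bounded by the integral over the annulus of
    K (Y psi_r)^(1-tau) X_r^tau, where the integral of X_r over the annulus is
    the quantity assumed bounded as r -> oo. By Young's inequality,
    J(r) = int Y psi_r is first bounded in r; then
    J(r) <= C_d (J(2r) - J(r/2)) + d for every d > 0, so that sup J = 0 and
    Y = 0 almost everywhere, although Y > 0 where |x| and u are large.

    Since H(u) psi_r is only C^1, the weak inequality is first extended to C^1
    test functions. A C^1 function of compact support is approximated by
    gluing its first-order Taylor polynomials at the points of a fine lattice
    with a smooth partition of unity. *)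

Set Implicit Arguments.
Unset Strict Implicit.
Unset Printing Implicit Defensive.

Import Order.TTheory GRing.Theory Num.Theory.
Import numFieldNormedType.Exports.

Local Open Scope classical_set_scope.
Local Open Scope ring_scope.

(** * Smooth cutoffs of one variable *)

(** The hypotheses bound the integral of X_r but do not make it small, so a single use of Young's
    inequality cannot give Y = 0. It is used with two opposite weights. A small weight on Y psi_r
    can be absorbed on the left and bounds J. A small weight on X_r then leaves, up to d, a large
    multiple of the integral of Y psi_r over the annulus only. Since psi_(2r) - psi_(r/2) = 1 there,
    this integral is at most J(2r) - J(r/2), which is small once J(r/2) is close to the supremum.
    The value of s is forced by matching the powers of u. The number m is taken so large that
    psi^(1-1/m) is below the power of psi which the geometric mean offers: 1/m <= tau in the
    gradient cases, 1/m <= tau/p in case (i_1). That H vanishes below k > 0 serves twice: the bound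
    f(u) >= c u^q is known for large u only, and t^s with 0 < s < 1 is not differentiable at 0. *)

(** The sequence of all derivatives is part of the data, so that an induction on the order of
    differentiation only has to shift it. *)
Definition smooth_fun {R : realType} (g : R -> R) : Prop :=
  exists G : nat -> R -> R,
    G 0 = g /\ forall k t, is_derive t (1 : R) (G k) (G k.+1 t).

(** Monomial by monomial: exp x >= 1 + x^i / i! for i > 0 gives x^i exp(-x) <= i!. *)
Lemma poly_expR_bounded {R : realType} (P : {poly R}) :
  exists C, forall x, 0 <= x -> `|P.[x]| * expR (- x) <= C.
Proof.
exists (\sum_(i < size P) `|P`_i| * i`!%:R) => x x0.
rewrite expRN ler_pdivrMr ?expR_gt0// mulr_suml horner_coef.
apply: (le_trans (ler_norm_sum _ _ _)); apply: ler_sum => i _.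
rewrite normrM -mulrA ler_wpM2l// normrX ger0_norm//.
case: (nat_of_ord i) => [|m].
  by rewrite expr0 fact0 mul1r -expR0 ler_expR.
have h := expR_ge1Dxn m x0.
apply: (@le_trans _ _ (x ^+ m.+1 / m.+1`!%:R * m.+1`!%:R)).
  by rewrite divfK// pnatr_eq0 -lt0n fact_gt0.
rewrite mulrC ler_wpM2l//; apply: le_trans h.
by rewrite lerDr.
Qed.

(** Serves at the point 0 where the two branches of [flat_gen] meet and no differentiation rule
    applies. *)
Lemma is_derive_quadratic {R : realType} (f : R -> R) (x C : R) :
  (forall h, `|f (x + h) - f x| <= C * h ^+ 2) -> is_derive x (1 : R) f 0.
Proof.
move=> fC.
have H : h^-1 *: (f (h + x) - f x) @[h --> (0 : R)^'] --> (0 : R).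
  apply/cvgr0Pnorm_le => e e0.
  have C0 : 0 <= C.
    by have := le_trans (normr_ge0 _) (fC 1); rewrite expr1n mulr1.
  have d0 : 0 < e / (C + 1) by rewrite divr_gt0// ltr_wpDl.
  near=> h.
  have h0 : h != 0 by near: h; exact: nbhs_dnbhs_neq.
  have hd : `|h| <= e / (C + 1).
    by near: h; apply: dnbhs0_le.
  rewrite normrM normfV ler_pdivrMl ?normr_gt0//.
  apply: (@le_trans _ _ (C * `|h| * `|h|)).
    by have := fC h; rewrite (addrC h) -mulrA -expr2 real_normK// num_real.
  rewrite mulrC ler_wpM2l//.
  apply: (@le_trans _ _ ((C + 1) * `|h|)); first by rewrite ler_wpM2r// lerDl.
  by rewrite -ler_pdivlMl ?ltr_wpDl// mulrC.
split.
  apply/cvg_ex; exists 0; move: H; apply: cvg_trans.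
  by apply: near_eq_cvg; near=> h; rewrite /= /GRing.scale/= mulr1.
rewrite /derive; apply/cvg_lim => //; move: H; apply: cvg_trans.
by apply: near_eq_cvg; near=> h; rewrite /= /GRing.scale/= mulr1.
Unshelve. all: by end_near. Qed.

Section flat.
Context {R : realType}.
Implicit Type P : {poly R}.

(* The functions [P(1/t) exp(-1/t)], extended by [0], are closed under
   differentiation: the derivative is that of [(P - P') X^2]. *)
Definition flat_gen P (t : R) : R :=
  if 0 < t then P.[t^-1] * expR (- t^-1) else 0.

Lemma is_derive_flat_gen P t :
  is_derive t (1 : R) (flat_gen P) (flat_gen ((P - P^`()) * 'X^2) t).
Proof.
have [t0|t0|->] := ltgtP t 0.
- rewrite {2}/flat_gen ltNge (ltW t0)/=.
  apply: near_eq_is_derive (is_derive_cst (0 : R) t 1).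
  near=> s; rewrite /flat_gen /cst ltNge ifF//; apply/negbF/ltW.
  by near: s; exact: lt_nbhsl.
- have H : is_derive t (1 : R) (fun s => P.[s^-1] * expR (- s^-1))
             (flat_gen ((P - P^`()) * 'X^2) t).
    have tn0 : t != 0 by rewrite gt_eqF.
    have dV : is_derive t (1 : R) (fun s : R => s^-1) (- t ^- 2).
      apply: is_derive_eq; first exact: (is_deriveV (f := id) tn0).
      by rewrite /GRing.scale/= mulr1.
    have dP : is_derive t (1 : R) (fun s : R => P.[s^-1])
       (P^`().[t^-1] * - t ^- 2).
      exact: (is_derive1_comp (f := horner P) (g := fun s : R => s^-1)).
    have dN : is_derive t (1 : R) (fun s : R => - s^-1) (t ^- 2).
      by have := is_deriveN dV; rewrite opprK.
    have dE : is_derive t (1 : R) (fun s : R => expR (- s^-1))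
       (expR (- t^-1) * t ^- 2).
      exact: (is_derive1_comp (f := expR) (g := fun s : R => - s^-1)).
    apply: (is_derive_eq (is_deriveM dP dE)).
    rewrite /flat_gen t0 !hornerE /GRing.scale/= -!exprVn; ring.
  apply: near_eq_is_derive H.
  near=> s; rewrite /flat_gen ifT//.
  by near: s; exact: lt_nbhsr.
- rewrite {2}/flat_gen ltxx.
  (* With x = 1/h, boundedness of P(x) x^2 exp(-x) says that |flat_gen P h| <= C h^2. *)
  have [C CP] := poly_expR_bounded (P * 'X^2).
  apply: (@is_derive_quadratic _ _ _ C) => h.
  have C0 : 0 <= C by apply: le_trans (CP 0 _); rewrite ?mulr_ge0 ?expR_ge0.
  rewrite add0r {2}/flat_gen ltxx subr0 /flat_gen; case: ifPn => h0; last first.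
    by rewrite normr0 mulr_ge0// sqr_ge0.
  have := CP h^-1; rewrite invr_ge0 (ltW h0) => /(_ isT).
  rewrite hornerM hornerXn normrM exprVn [`|h ^- 2|]ger0_norm; last first.
    by rewrite invr_ge0 sqr_ge0.
  rewrite mulrAC.
  rewrite ler_pdivrMr ?exprn_gt0//; apply: le_trans.
  by rewrite normrM (ger0_norm (expR_ge0 _)).
Unshelve. all: by end_near. Qed.

Definition flat : R -> R := flat_gen 1.

Lemma flatE t : flat t = if 0 < t then expR (- t^-1) else 0.
Proof. by rewrite /flat /flat_gen hornerE mul1r. Qed.

Lemma smooth_flat : smooth_fun flat.
Proof.
exists (fun k => flat_gen (iter k (fun P => (P - P^`()) * 'X^2) 1)); split=> //.
by move=> k t; exact: is_derive_flat_gen.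
Qed.

Lemma flat_ge0 t : 0 <= flat t.
Proof. by rewrite flatE; case: ifP => // _; exact: expR_ge0. Qed.

Lemma flat_eq0 t : t <= 0 -> flat t = 0.
Proof. by move=> t0; rewrite flatE ltNge t0. Qed.

Lemma flat_gt0 t : 0 < t -> 0 < flat t.
Proof. by move=> t0; rewrite flatE t0 expR_gt0. Qed.

Lemma flat_le s t : s <= t -> flat s <= flat t.
Proof.
move=> st; have [s0|s0] := leP s 0; first by rewrite flat_eq0// flat_ge0.
rewrite !flatE s0 (lt_le_trans s0 st) ler_expR lerN2 lef_pV2 ?posrE//.
exact: lt_le_trans st.
Qed.

(* Locked: otherwise failed unifications unfold it down to [expR]. *)
Definition step : R -> R :=
  locked (fun t => flat (flat 1 - flat t) / flat (flat 1)).

(** The inner difference is flat 1 for t <= 0 and nonpositive for t >= 1. Nesting [flat] thus gives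
    a smooth transition from 1 to 0 whose denominator is constant, so that no quotient has to be
    differentiated. *)
Lemma stepE t : step t = flat (flat 1 - flat t) / flat (flat 1).
Proof. by rewrite /step -lock. Qed.

Lemma step1 t : t <= 0 -> step t = 1.
Proof.
by move=> t0; rewrite stepE (flat_eq0 t0) subr0 divff// gt_eqF// !flat_gt0.
Qed.

Lemma step0 t : 1 <= t -> step t = 0.
Proof. by move=> t1; rewrite stepE flat_eq0 ?mul0r// subr_le0 flat_le. Qed.

Lemma step_ge0 t : 0 <= step t.
Proof. by rewrite stepE divr_ge0 ?flat_ge0. Qed.

Lemma step_le1 t : step t <= 1.
Proof.
rewrite stepE ler_pdivrMr ?mul1r ?flat_gt0// ?flat_gt0//.
by rewrite flat_le// gerBl flat_ge0.
Qed.

End flat.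

(** * Calculus in the classes C^k *)

Section class_C.
Context {R : realType} {n : nat}.
Implicit Types (x y : 'rV[R]_n) (u v : 'rV[R]_n -> R).

Definition smooth u := forall k, of_class_C k u.

Lemma derive_partial u x y : differentiable u x ->
  'D_y u x = \sum_(i < n) y ord0 i * partial i u x.
Proof.
move=> du; rewrite deriveE// {1}(row_sum_delta y) linear_sum.
by apply: eq_bigr => i _; rewrite linearZ /partial deriveE.
Qed.

Lemma differentiable_fun_comp (g : R -> R) dg u x :
  is_derive (u x) (1 : R) g dg -> differentiable u x ->
  differentiable (fun z => g (u z)) x /\
  forall i, partial i (fun z => g (u z)) x = dg * partial i u x.
Proof.
move=> dg1 du.
have dgd : differentiable g (u x) by apply/derivable1_diffP; exact: ex_derive.
split=> [|i]; first exact: (differentiable_comp du dgd).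
rewrite /partial deriveE; last exact: (differentiable_comp du dgd).
rewrite (diff_comp du dgd)/= -(deriveE _ du).
rewrite -[X in 'd g _ X]mulr1 -[_ * 1]/(_ *: 1) linearZ/= -(deriveE _ dgd).
by rewrite (derive_val (df := dg)) /GRing.scale/= mulrC.
Qed.

Lemma partial_cst c i : partial i (fun _ : 'rV[R]_n => c) = (fun _ => 0 : R).
Proof. by apply/funext => x; rewrite /partial (derive_cst). Qed.

Lemma partialD u v i x : differentiable u x -> differentiable v x ->
  partial i (fun z => u z + v z) x = partial i u x + partial i v x.
Proof.
move=> du dv; rewrite /partial.
exact: (deriveD (diff_derivable (v := delta_mx ord0 i) du) (diff_derivable (v := delta_mx ord0 i) dv)).
Qed.

Lemma partialM u v i x : differentiable u x -> differentiable v x ->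
  partial i (fun z => u z * v z) x = u x * partial i v x + v x * partial i u x.
Proof.
move=> du dv; rewrite /partial.
exact: (deriveM (diff_derivable (v := delta_mx ord0 i) du) (diff_derivable (v := delta_mx ord0 i) dv)).
Qed.


Lemma of_class_CS k u : of_class_C k.+1 u -> of_class_C k u.
Proof.
elim: k u => [u [du _] x|k IH u [du pu]]; first exact: differentiable_continuous.
by split=> // i; apply: IH; exact: pu.
Qed.

Lemma of_class_C_cst k (c : R) : of_class_C k (fun _ : 'rV[R]_n => c : R).
Proof.
elim: k c => [|k IH] c; first exact: cst_continuous.
by split=> [x|i]; [exact: differentiable_cst|rewrite partial_cst; exact: IH].
Qed.

Lemma of_class_CD k u v :
  of_class_C k u -> of_class_C k v -> of_class_C k (fun x => u x + v x).
Proof.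
elim: k u v => [|k IH] u v /=.
  by move=> cu cv x; apply: (cvgD (cu x) (cv x)).
move=> [du pu] [dv pv]; split=> [x|i]; first exact: differentiableD.
rewrite (_ : partial i _ = fun x => partial i u x + partial i v x).
  by apply: IH.
by apply/funext => x; rewrite partialD.
Qed.

Lemma of_class_CM k u v :
  of_class_C k u -> of_class_C k v -> of_class_C k (fun x => u x * v x).
Proof.
elim: k u v => [|k IH] u v.
  by move=> cu cv x; apply: (cvgM (cu x) (cv x)).
move=> Cu Cv; have [[du pu] [dv pv]] := (Cu, Cv).
split=> [x|i]; first exact: differentiableM.
rewrite (_ : partial i _ =
    fun x => u x * partial i v x + v x * partial i u x).
  apply: of_class_CD; apply: IH; by [exact: of_class_CS|exact: pu|exact: pv].
by apply/funext => x; rewrite partialM.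
Qed.

Lemma of_class_C_fun_comp k (G : nat -> R -> R) u :
  (forall k t, is_derive t (1 : R) (G k) (G k.+1 t)) ->
  of_class_C k u -> of_class_C k (fun x => G 0 (u x)).
Proof.
elim: k G => [|k IH] G dG Cu.
  move=> x; apply: continuous_comp; first exact: Cu.
  by apply: differentiable_continuous; apply/derivable1_diffP; exact: ex_derive.
have [du pu] := Cu.
split=> [x|i]; first by case: (differentiable_fun_comp (dG 0 (u x)) (du x)).
rewrite (_ : partial i _ = fun x => G 1 (u x) * partial i u x).
  apply: of_class_CM; last exact: pu.
  by apply: (IH (fun k => G k.+1)) => //; exact: of_class_CS.
apply/funext => x.
by case: (differentiable_fun_comp (dG 0 (u x)) (du x)) => _ ->.
Qed.

Lemma smooth_comp g u : smooth_fun g -> smooth u -> smooth (fun x => g (u x)).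
Proof. by move=> [G [<- dG]] Cu k; exact: of_class_C_fun_comp. Qed.

Lemma smooth_cst c : smooth (fun _ : 'rV[R]_n => c : R).
Proof. by move=> k; exact: of_class_C_cst. Qed.

Lemma smoothD u v : smooth u -> smooth v -> smooth (fun x => u x + v x).
Proof. by move=> Cu Cv k; exact: of_class_CD. Qed.

Lemma smoothM u v : smooth u -> smooth v -> smooth (fun x => u x * v x).
Proof. by move=> Cu Cv k; exact: of_class_CM. Qed.

Lemma smooth_differentiable u x : smooth u -> differentiable u x.
Proof. by move=> /(_ 1%N)[]. Qed.

Lemma of_class_C_sum k (I : Type) (r : seq I) (F : I -> 'rV[R]_n -> R) :
  (forall i, of_class_C k (F i)) ->
  of_class_C k (fun x => \sum_(i <- r) F i x).
Proof.
move=> sF; elim: r => [|i r IH].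
  by under eq_fun do rewrite big_nil; exact: of_class_C_cst.
by under eq_fun do rewrite big_cons; exact: of_class_CD.
Qed.

Lemma smooth_sum (I : Type) (r : seq I) (F : I -> 'rV[R]_n -> R) :
  (forall i, smooth (F i)) -> smooth (fun x => \sum_(i <- r) F i x).
Proof. by move=> sF k; apply: of_class_C_sum => i; exact: sF. Qed.

Lemma smooth_prod (I : Type) (r : seq I) (F : I -> 'rV[R]_n -> R) :
  (forall i, smooth (F i)) -> smooth (fun x => \prod_(i <- r) F i x).
Proof.
move=> sF; elim: r => [|i r IH].
  by under eq_fun do rewrite big_nil; exact: smooth_cst.
by under eq_fun do rewrite big_cons; exact: smoothM.
Qed.

Lemma smoothX u k : smooth u -> smooth (fun x => u x ^+ k).
Proof.
move=> su; elim: k => [|k IH].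
  by under eq_fun do rewrite expr0; exact: smooth_cst.
by under eq_fun do rewrite exprS; exact: smoothM.
Qed.

Lemma partial_coord (i j : 'I_n) :
  partial i (fun x => x ord0 j) = (fun _ : 'rV[R]_n => (i == j)%:R : R).
Proof.
apply/funext => x; rewrite /partial /derive; apply/cvg_lim => //.
apply: (cvg_trans _ (cvg_cst ((i == j)%:R : R))).
apply: near_eq_cvg.
near=> h; have h0 : h != 0 by near: h; exact: nbhs_dnbhs_neq.
rewrite /= !mxE addrK eqxx/= eq_sym.
by rewrite -[_ *: _]/(h^-1 * (h * _)) mulKf.
exact: dnbhs_filter.
Unshelve. all: by end_near. Qed.

Lemma smooth_coord (j : 'I_n) : smooth (fun x => x ord0 j).
Proof.
case=> [x|k]; first exact: coord_continuous.
split=> [x|i]; first exact: differentiable_coord.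
by rewrite partial_coord; exact: of_class_C_cst.
Qed.

Lemma partial_sum (I : Type) (r : seq I) (F : I -> 'rV[R]_n -> R) i x :
  (forall j, differentiable (F j) x) ->
  partial i (fun x => \sum_(j <- r) F j x) x = \sum_(j <- r) partial i (F j) x.
Proof.
move=> dF; suff [//] : differentiable (fun x => \sum_(j <- r) F j x) x /\
  partial i (fun x => \sum_(j <- r) F j x) x = \sum_(j <- r) partial i (F j) x.
elim: r => [|j r [IHd IHp]].
  under eq_fun do rewrite big_nil.
  by rewrite partial_cst big_nil; split=> //; exact: differentiable_cst.
under eq_fun do rewrite big_cons.
by rewrite partialD// IHp big_cons; split=> //; exact: differentiableD.
Qed.

End class_C.

(** * Lebesgue measure on R^n *)

Section rV_measure.
Context {R : realType} {n : nat}.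
Implicit Types (x y : 'rV[R]_n) (u v : 'rV[R]_n -> R).

Lemma coord_le_norm x i : `|x ord0 i| <= `|x|.
Proof.
rewrite [leRHS]/Num.norm/= mx_normrE.
by apply: (le_trans _ (le_bigmax _ _ (ord0, i))).
Qed.

Lemma norm_lt_coord x (e : R) :
  0 < e -> (forall i, `|x ord0 i| < e) -> `|x| < e.
Proof.
move=> e0 xe; rewrite [ltLHS]/Num.norm/= mx_normrE.
by apply/bigmax_ltP; split=> // -[i j] _ /=; rewrite ord1.
Qed.

Lemma measurable_all_coord (P : 'I_n -> set R) : (forall i, measurable (P i)) ->
  measurable [set x : 'rV[R]_n | forall i, P i (x ord0 i)].
Proof.
move=> mP; rewrite (_ : [set _ | _] =
    \bigcap_(i in [set: 'I_n]) [set x : 'rV[R]_n | P i (x ord0 i)]).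
  apply: fin_bigcap_measurable => // i _.
  by have := measurable_coord i measurableT (mP i); rewrite setTI.
by apply/seteqP; split=> x /= h i; [move=> _; exact: h|exact: h].
Qed.

(** The sigma-algebra is generated by the coordinates, so an open set is written as the union of the
    countably many rational boxes that it contains. *)
Lemma open_measurable_rV (U : set 'rV[R]_n) : open U -> measurable U.
Proof.
move=> oU.
pose box (z : {ffun 'I_n -> rat} * rat) :=
  [set x : 'rV[R]_n | forall i, x ord0 i \in `](ratr (z.1 i) - ratr z.2 : R),
                                    (ratr (z.1 i) + ratr z.2 : R)[].
pose F k := if unpickle k is Some z then
  if `[< box z `<=` U >] then box z else set0 else set0.
have -> : U = \bigcup_k F k.
  apply/seteqP; split=> [x Ux|x [k _]]; last first.
    by rewrite /F; case: unpickle => // z; case: asboolP => // + bx; exact.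
  have /nbhs_ballP[e /= e0 eU] : nbhs x U by exact: open_nbhs_nbhs.
  (* A box of half side d whose centre is within d of x stays within 2d < e of x. *)
  have /rat_in_itvoo[d] : 0 < e / 2 by rewrite divr_gt0.
  rewrite in_itv/= => /andP[d0 de].
  have q_ i : {q : rat | ratr q \in `](x ord0 i - ratr d), (x ord0 i + ratr d)[}.
    apply/cid; apply: rat_in_itvoo.
    by rewrite ltrBlDr -addrA ltrDl addr_gt0.
  pose z := ([ffun i => sval (q_ i)], d).
  have bzU : box z `<=` U.
    move=> y /= By; apply: eU; rewrite -ball_normE/= ; apply: norm_lt_coord => // i.
    rewrite !mxE; have := By i; rewrite ffunE; case: (q_ i) => q /=.
    by rewrite !in_itv/= => /andP[? ?] /andP[? ?]; rewrite ltr_norml; apply/andP; split; lra.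
  exists (pickle z) => //; rewrite /F pickleK; case: asboolP => // _ i /=.
  rewrite ffunE; case: (q_ i) => q /=.
  by rewrite !in_itv/= => /andP[? ?]; apply/andP; split; lra.
apply: bigcupT_measurable => k; rewrite /F.
case: unpickle => // z; case: asboolP => // _.
exact: (@measurable_all_coord (fun i => [set` _])).
Qed.

Lemma measurable_lebesgue (A : set 'rV[R]_n) : measurable A ->
  measurable (A : set (caratheodory_type ((@lebesgue_rV_borel R n)^*)%mu)).
Proof. by move=> mA; exact: caratheodory_measurable_mu_ext. Qed.

Lemma lebesgue_rVE (A : set 'rV[R]_n) : measurable A ->
  lebesgue_rV n A = lebesgue_rV_borel n A.
Proof. by move=> mA; exact: measurable_mu_extE. Qed.

Lemma continuous_lebesgue_measurable u :
  continuous u -> lebesgue_measurable_fun u.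
Proof.
move=> cu; apply: (measurability _ (RGenOpens.measurableE R)) => //.
move=> _ [_ [a [b ->] <-]]; rewrite setTI.
apply: measurable_lebesgue; apply: open_measurable_rV.
by move/continuousP : cu; apply; exact: interval_open.
Qed.

End rV_measure.

Section rV_box.
Context {R : realType}.

(** Used twice: cubes have finite measure, and a unit cube, having measure 1, is not negligible. *)
Lemma lebesgue_rV_box n (a b : R) : a <= b ->
  lebesgue_rV n [set x : 'rV[R]_n | forall i, a <= x ord0 i <= b] =
  ((b - a) ^+ n)%:E.
Proof.
move=> ab.
have mbox m : measurable [set x : 'rV[R]_m | forall i, a <= x ord0 i <= b].
  rewrite (_ : [set _ | _] =
    [set x : 'rV[R]_m | forall i, `[a, b]%classic (x ord0 i)]).
    by apply: (@measurable_all_coord _ _ (fun=> `[a, b]%classic)).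
  by apply/seteqP; split=> x /= + i => /(_ i); rewrite in_itv.
rewrite lebesgue_rVE//; elim: n => [|n IH].
  by rewrite /= diracE mem_set// => -[].
transitivity ((lebesgue_measure \x lebesgue_rV_borel n)%E (@rV_cons R n @^-1`
    [set x : 'rV[R]_n.+1 | forall i, a <= x ord0 i <= b])) => //.
rewrite (_ : @rV_cons R n @^-1` _ =
    `[a, b]%classic `*` [set x : 'rV[R]_n | forall i, a <= x ord0 i <= b]).
  rewrite product_measure1E//; last exact: mbox.
  transitivity (lebesgue_measure (`[a, b]%classic : set R) * ((b - a) ^+ n)%:E)%E.
    by rewrite -IH.
  rewrite lebesgue_measure_itv/= lte_fin.
  case: ltgtP ab => // [ab _|-> _]; first by rewrite -EFinB -EFinM exprS.
  by rewrite mul0e subrr expr0n.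
apply/seteqP; split=> [[y z] /= h|[y z] /= [yab h] i].
  split; first by have := h ord0; rewrite rV_cons0 in_itv.
  by move=> i; have := h (lift ord0 i); rewrite rV_cons_lift.
have [j ->|->] := unliftP ord0 i; first by rewrite rV_cons_lift.
by rewrite rV_cons0; move: yab; rewrite in_itv.
Qed.

End rV_box.

(** * Density of smooth functions in C^1_c *)

Section taylor.
Context {R : realType} {n : nat}.
Implicit Types (x y z : 'rV[R]_n) (u v : 'rV[R]_n -> R).

(** Only x is confined to K; y may leave it. This is what functions supported in K require, as pairs
    of points straddle the boundary. *)
Lemma uniformly_continuous_near_compact u (K : set 'rV[R]_n) (e : R) :
  compact K -> continuous u -> 0 < e ->
  exists2 d, 0 < d & forall x y, K x -> `|x - y| <= d -> `|u x - u y| <= e.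
Proof.
move=> cK cu e0.
pose P (d : R) x := forall y, `|x - y| <= d -> `|u x - u y| <= e.
have H : \forall d \near (0 : R)^'+, K `<=` P d.
  apply: ((compact_near_coveringP K).1 cK) => x Kx.
  have /cvgrPdist_le/(_ (e / 2)) := cu x.
  rewrite divr_gt0// => /(_ isT) /nbhs_ballP[r /= r0 rU].
  exists (ball x (r / 2), [set d | d < r / 2]).
    split; first by apply: nbhsx_ballx; rewrite divr_gt0.
    by apply: nbhs_right_lt; rewrite divr_gt0.
  move=> [x' d]/= [bx' dr] y xy.
  have bx : `|u x - u x'| <= e / 2.
    by apply: rU; apply: le_ball bx'; rewrite ler_pdivrMr// ler_peMr// ?ler1n// ltW.
  have bxy : `|u x - u y| <= e / 2.
    apply: rU; rewrite [r]splitr -ball_normE/=.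
    rewrite -(subrK x' x) -addrA; apply: (le_lt_trans (ler_normD _ _)).
    rewrite ltr_leD// ?(le_trans xy (ltW dr))//.
    by move: bx'; rewrite -ball_normE.
  rewrite [leRHS]splitr -(subrK (u x) (u x')) -addrA.
  by apply: (le_trans (ler_normD _ _)); rewrite lerD// distrC.
have : \forall d \near (0 : R)^'+, 0 < d /\ K `<=` P d.
  near=> d; split; first by near: d; exact: nbhs_right_gt.
  by near: d; exact: H.
move=> /filter_ex[d [d0 KP]]; exists d => // x y Kx; exact: KP.
Unshelve. all: by end_near. Qed.

Lemma is_derive_line u x y (t : R) : differentiable u (x + t *: y) ->
  is_derive t (1 : R) (fun s => u (x + s *: y)) ('D_y u (x + t *: y)).
Proof.
move=> du; have /derivableP[] := diff_derivable (v := y) du.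
have E : (fun h : R => h^-1 *: (((fun s => u (x + s *: y)) \o shift t)
      (h *: (1 : R)) - u (x + t *: y))) =
    (fun h : R => h^-1 *: ((u \o shift (x + t *: y)) (h *: y) - u (x + t *: y))).
  apply/funext => h /=; congr (_ *: (u _ - _)).
  by rewrite -[h *: 1]/(h * 1) mulr1 scalerDl addrCA.
move=> d _; split; first by rewrite /derivable E.
by rewrite /derive E.
Qed.

(** Mean value theorem on [0, 1] for t |-> u(z + t(x - z)) minus its linear part. The factor n comes
    from bounding each coordinate of x - z by the sup norm. *)
Lemma taylor_le u (d e : R) x z :
  (forall y, differentiable u y) ->
  (forall i y, `|z - y| <= d -> `|partial i u z - partial i u y| <= e) ->
  `|x - z| <= d ->
  `|u x - (u z + \sum_(i < n) partial i u z * (x ord0 i - z ord0 i))|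
    <= n%:R * e * `|x - z|.
Proof.
move=> du ue xzd.
pose s := \sum_(i < n) partial i u z * (x ord0 i - z ord0 i).
pose h t := u (z + t *: (x - z)) - t * s.
have dh t : is_derive t (1 : R) h ('D_(x - z) u (z + t *: (x - z)) - s).
  apply: is_deriveB; first exact: is_derive_line.
  apply: (is_derive_eq (is_deriveM (is_derive_id t (1 : R)) (is_derive_cst s t (1 : R)))).
  by rewrite scaler0 add0r -[_ *: _]/(s * 1) mulr1.
have hc0 : {within `[0, 1], continuous h}.
  apply: continuous_subspaceT => t; apply: differentiable_continuous.
  by apply/derivable1_diffP; exact: ex_derive.
have [c] := MVT_segment ler01 (fun t _ => dh t) hc0.
rewrite in_itv/= => /andP[c0 c1].
rewrite /h scale1r scale0r mul1r mul0r !subr0 addr0 mulr1 subrKC => hc.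
have -> : u x - (u z + s) = 'D_(x - z) u (z + c *: (x - z)) - s.
  by rewrite -hc; ring.
rewrite derive_partial// -sumrB; apply: (le_trans (ler_norm_sum _ _ _)).
apply: (@le_trans _ _ (\sum_(i < n) e * `|x - z|)); last first.
  by rewrite sumr_const card_ord -mulrA mulr_natl.
apply: ler_sum => i _; rewrite !mxE mulrC -mulrBl normrM.
apply: ler_pM => //; last by have := coord_le_norm (x - z) i; rewrite !mxE.
rewrite distrC; apply: ue; rewrite opprD addrA subrr add0r normrN normrZ ger0_norm//.
by apply: le_trans xzd; rewrite ler_piMl.
Qed.

End taylor.

(** * One-dimensional partition of unity by translates of a bump *)

Section step_calculus.
Context {R : realType}.

Lemma step_le (s t : R) : s <= t -> step t <= step s.
Proof.
move=> st; rewrite !stepE; apply: ler_wpM2r; first by rewrite invr_ge0 flat_ge0.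
by apply: flat_le; apply: lerB => //; exact: flat_le.
Qed.

Lemma smooth_step_comp n (w : 'rV[R]_n -> R) :
  smooth w -> smooth (fun x => step (w x)).
Proof.
move=> sw; under eq_fun do rewrite stepE; apply: smoothM; last exact: smooth_cst.
apply: (smooth_comp smooth_flat); apply: smoothD; first exact: smooth_cst.
rewrite (_ : (fun x => - flat (w x)) = (fun x => -1 * flat (w x))); last first.
  by apply/funext => x; rewrite mulN1r.
apply: smoothM; first exact: smooth_cst.
exact: (smooth_comp smooth_flat).
Qed.

(** The derivative is continuous and vanishes off [0, 1], so its maximum on this interval bounds it
    everywhere. *)
Lemma step_derive : exists (ds : R -> R) (C : R),
  [/\ forall t, is_derive t (1 : R) step (ds t), forall t, `|ds t| <= C &
      forall t, t < 0 \/ 1 < t -> ds t = 0].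
Proof.
pose df : R -> R := flat_gen ((1 - 1^`()) * 'X^2).
have fd t : is_derive t (1 : R) (@flat R) (df t) by exact: is_derive_flat_gen.
have dfc : continuous df.
  move=> t; apply: differentiable_continuous; apply/derivable1_diffP.
  by apply: ex_derive; exact: is_derive_flat_gen.
have fc : continuous (@flat R).
  by move=> t; apply: differentiable_continuous; apply/derivable1_diffP; exact: ex_derive.
pose c : R := (flat (flat 1))^-1.
pose ds t := - (df (flat 1 - flat t) * df t) * c.
have sd t : is_derive t (1 : R) step (ds t).
  rewrite (_ : step = fun t => flat (flat 1 - flat t) * c); last first.
    by apply/funext => s; rewrite stepE.
  have dN : is_derive t (1 : R) (fun t => flat 1 - flat t : R) (- df t).
    have := is_deriveB (is_derive_cst (flat 1 : R) t (1 : R)) (fd t).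
    by rewrite sub0r.
  have := is_derive1_comp (f := flat) (g := fun t => flat 1 - flat t) (fd _) dN.
  move=> H; apply: (is_derive_eq (is_deriveM H (is_derive_cst c t (1 : R)))).
  by rewrite scaler0 add0r /ds -[_ *: _]/(c * _) mulrC mulrN.
have z t : t < 0 \/ 1 < t -> ds t = 0.
  case=> [t0|t1]; rewrite /ds.
    by rewrite {2}/df /flat_gen ltNge (ltW t0)/= mulr0 oppr0 mul0r.
  rewrite {1}/df /flat_gen ifF ?mul0r ?oppr0 ?mul0r//.
  by apply/negbTE; rewrite -leNgt subr_le0 flat_le// ltW.
have dsc : continuous ds.
  move=> t; apply: cvgM; last exact: cvg_cst.
  apply: cvgN; apply: cvgM; last exact: dfc.
  have h : (flat 1 - flat x : R) @[x --> t] --> (flat 1 - flat t : R).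
    by apply: cvgB; [exact: cvg_cst|exact: fc].
  exact: (cvg_comp _ _ h (dfc _)).
have [M HM] : exists M, forall t, t \in `[0, 1] -> `|ds t| <= M.
  have [] := @EVT_max R (fun t => `|ds t|) 0 1 ler01.
    by apply: continuous_subspaceT => t; apply: (cvg_norm (dsc t)).
  by move=> m _ mM; exists `|ds m|.
exists ds, (Num.max M 0); split=> // t.
have [t0|t0] := ltP t 0; first by rewrite z ?normr0 ?le_max ?lexx ?orbT//; left.
have [t1|t1] := ltP 1 t; first by rewrite z ?normr0 ?le_max ?lexx ?orbT//; right.
by rewrite le_max HM// in_itv/= t0 t1.
Qed.

(** A difference of consecutive translates of [step]: sums over integer translates telescope, so the
    bumps form a partition of unity without normalisation. *)
Definition hat (t : R) : R := step t - step (t + 1).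

(** Equals hat(t-1) + hat(t) + hat(t+1). It is 1 on the support of [hat] and its lattice sums are at
    most 3, so it controls sums of |hat'| whatever the number of nodes. *)
Definition fat (t : R) : R := step (t - 1) - step (t + 2).

Lemma hat_ge0 t : 0 <= hat t.
Proof. by rewrite subr_ge0 step_le// lerDl. Qed.

Lemma fat_ge0 t : 0 <= fat t.
Proof. by rewrite subr_ge0 step_le//; lra. Qed.

Lemma hat_le_fat t : hat t <= fat t.
Proof. by rewrite lerB// step_le//; lra. Qed.

Lemma hat_eq0 t : 1 <= `|t| -> hat t = 0.
Proof.
rewrite ler_normr => /orP[t1|t1]; rewrite /hat.
  by rewrite !step0 ?subrr//; lra.
by rewrite !step1 ?subrr//; lra.
Qed.

Lemma fat_eq1 t : `|t| <= 1 -> fat t = 1.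
Proof.
rewrite ler_norml => /andP[t1 t2]; rewrite /fat step1; last lra.
by rewrite step0 ?subr0//; lra.
Qed.

Lemma sum_hat (M : nat) t :
  \sum_(j < M.*2.+1) hat (t - (j%:R - M%:R)) = step (t - M%:R) - step (t + M%:R + 1).
Proof.
pose F j : R := step (t + M%:R + 1 - j%:R).
rewrite (eq_bigr (fun j : 'I__ => F j.+1 - F j)).
  rewrite -(big_mkord predT (fun j => F j.+1 - F j)) telescope_sumr//.
  rewrite /F subr0; congr (step _ - _).
  rewrite -addnn -addn1 !natrD; ring.
by move=> j _; rewrite /hat /F; congr (step _ - step _); rewrite ?mulrS; ring.
Qed.

Lemma sum_hat_eq1 (M : nat) t : `|t| <= M%:R ->
  \sum_(j < M.*2.+1) hat (t - (j%:R - M%:R)) = 1.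
Proof.
rewrite ler_norml => /andP[t1 t2]; rewrite sum_hat step1; last lra.
by rewrite step0 ?subr0//; lra.
Qed.

Lemma sum_fat_le3 (M : nat) t :
  \sum_(j < M.*2.+1) fat (t - (j%:R - M%:R)) <= 3.
Proof.
rewrite (eq_bigr (fun j : 'I__ => hat (t - 1 - (j%:R - M%:R)) +
  hat (t - (j%:R - M%:R)) + hat (t + 1 - (j%:R - M%:R)))).
  rewrite big_split/= big_split/= !sum_hat.
  have := step_le1 (t - 1 - M%:R); have := step_ge0 (t - 1 + M%:R + 1).
  have := step_le1 (t - M%:R); have := step_ge0 (t + M%:R + 1).
  have := step_le1 (t + 1 - M%:R); have := step_ge0 (t + 1 + M%:R + 1); lra.
move=> j _; rewrite /fat /hat.
set a : R := j%:R - M%:R.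
rewrite (_ : t - 1 - a + 1 = t - a); last by ring.
rewrite (_ : t + 1 - a + 1 = t - a + 2); last by ring.
rewrite (_ : t - a + 1 = t + 1 - a); last by ring.
rewrite (_ : t - a - 1 = t - 1 - a); last by ring.
ring.
Qed.

Lemma hat_derive : exists2 dh : R -> R, forall t, is_derive t (1 : R) hat (dh t) &
  exists2 C, 0 <= C & forall t, `|dh t| <= C * fat t.
Proof.
have [ds [C [dsE dsC ds0]]] := step_derive.
have C0 : 0 <= C by apply: le_trans (dsC 0).
exists (fun t => ds t - ds (t + 1)).
  move=> t; apply: is_deriveB.
  have := is_derive1_comp (f := step) (g := shift 1) (dsE (t + 1))
    (is_derive_shift t (1 : R) 1).
  by rewrite mulr1.
exists (C + C); first by rewrite addr_ge0.
move=> t; have [t1|t1] := leP `|t| 1.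
  by rewrite fat_eq1// mulr1; apply: (le_trans (ler_normB _ _)); exact: lerD.
have h : t < -1 \/ 1 < t.
  by move: t1; rewrite ltr_normr => /orP[]; [right|left; lra].
rewrite (ds0 t); last by case: h => h; [left|right]; lra.
rewrite (ds0 (t + 1)); last by case: h => h; [left|right]; lra.
by rewrite subrr normr0; apply: mulr_ge0; [exact: addr_ge0|exact: fat_ge0].
Qed.

End step_calculus.

Section density.
Context {R : realType} {n : nat}.
Implicit Types (x y z : 'rV[R]_n) (u v : 'rV[R]_n -> R).

Definition cube (L : R) : set 'rV[R]_n := [set x | forall i, `|x ord0 i| <= L].

Lemma cube_norm L x : cube L x -> 0 <= L -> `|x| <= L.
Proof.
move=> xL L0; rewrite [leLHS]/Num.norm/= mx_normrE.
by apply/bigmax_leP; split=> // -[i j] _ /=; rewrite ord1.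
Qed.

Lemma closed_cube L : closed (cube L).
Proof.
rewrite (_ : cube L = \bigcap_(i in [set: 'I_n])
    [set x : 'rV[R]_n | `|x ord0 i| <= L]); last first.
  by apply/seteqP; split=> x /= h i; [move=> _; exact: h|exact: h].
apply: closed_bigI => i _.
apply: (@closed_comp _ _ (fun x : 'rV[R]_n => `|x ord0 i|) [set t | t <= L]).
  by move=> x _; exact: (cvg_norm (@coord_continuous R 1 n ord0 i x)).
exact: closed_le.
Qed.

Lemma compact_cube L : compact (cube L).
Proof.
apply: bounded_closed_compact; last exact: closed_cube.
exists `|L|; split; first exact: num_real.
move=> M LM x xL; apply: (le_trans _ (ltW LM)).
apply: cube_norm => // i; apply: (le_trans (xL i)); exact: ler_norm.
Qed.

Lemma cube_le (L L' : R) : L <= L' -> cube L `<=` cube L'.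
Proof. by move=> LL x xL i; exact: le_trans LL. Qed.

Lemma partial_locally_cst u (U : set 'rV[R]_n) c i x :
  open U -> (forall y, U y -> u y = c) -> U x -> partial i u x = 0.
Proof.
move=> oU Uc Ux; rewrite /partial.
rewrite (@near_eq_derive _ _ _ u (fun _ => c)); first exact: derive_cst.
by apply: filterS (open_nbhs_nbhs (conj oU Ux)) => y /Uc.
Qed.

Lemma partial_off_cube u L i x : (forall y, ~ cube L y -> u y = 0) ->
  ~ cube L x -> partial i u x = 0.
Proof.
move=> u0 xL; apply: (@partial_locally_cst _ (~` cube L) 0) => //.
exact/closed_openC/closed_cube.
Qed.

Lemma partial_indep u i x : (forall h, u (h *: delta_mx ord0 i + x) = u x) ->
  partial i u x = 0.
Proof.
move=> ux; rewrite /partial /derive.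
rewrite (_ : (fun h : R => _) = (fun=> 0)); first by rewrite lim_cst.
by apply/funext => h /=; rewrite ux subrr scaler0.
Qed.

Lemma smooth_compact_test u L : smooth u -> (forall x, ~ cube L x -> u x = 0) ->
  test_function u.
Proof.
move=> su u0; split=> //; apply: subclosed_compact (@compact_cube L) _ => //.
  exact: closed_closure.
rewrite closureE => x; apply; split; first exact: closed_cube.
by move=> y /= uy0; apply: contrapT => /u0 /eqP; exact/negP.
Qed.

(** * Tensor-product partition of unity on a lattice of mesh 1/l *)

Section partition_of_unity.
Variables (l : R) (M : nat).
Hypothesis l0 : 0 < l.

Local Notation idx := {ffun 'I_n -> 'I_M.*2.+1}.
Implicit Type m : idx.

Definition node m : 'rV[R]_n := \row_i (((m i)%:R - M%:R) / l).

Definition weight m x := \prod_(i < n) hat (l * x ord0 i - ((m i)%:R - M%:R)).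

Definition fat_weight m x := \prod_(i < n) fat (l * x ord0 i - ((m i)%:R - M%:R)).

Lemma weight_ge0 m x : 0 <= weight m x.
Proof. by apply: prodr_ge0 => i _; exact: hat_ge0. Qed.

Lemma fat_weight_ge0 m x : 0 <= fat_weight m x.
Proof. by apply: prodr_ge0 => i _; exact: fat_ge0. Qed.

Lemma smooth_scaled_coord m i :
  smooth (fun x => l * x ord0 i - ((m i)%:R - M%:R)).
Proof.
apply: smoothD; last exact: smooth_cst.
by apply: smoothM; [exact: smooth_cst|exact: smooth_coord].
Qed.

Lemma smooth_hat_coord m i :
  smooth (fun x => hat (l * x ord0 i - ((m i)%:R - M%:R))).
Proof.
rewrite /hat (_ : (fun x => _) = (fun x =>
    step (l * x ord0 i - ((m i)%:R - M%:R)) +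
    -1 * step (l * x ord0 i - ((m i)%:R - M%:R) + 1))); last first.
  by apply/funext => x; rewrite mulN1r.
apply: smoothD; first exact/smooth_step_comp/smooth_scaled_coord.
apply: smoothM; first exact: smooth_cst.
apply: smooth_step_comp; apply: smoothD; first exact: smooth_scaled_coord.
exact: smooth_cst.
Qed.

Lemma smooth_weight m : smooth (weight m).
Proof. by apply: smooth_prod => i; exact: smooth_hat_coord. Qed.

Lemma weight_eq0 m x : l^-1 < `|x - node m| -> weight m x = 0.
Proof.
move=> xm; apply: contrapT => w0.
have : `|x - node m| <= l^-1; last by rewrite leNgt xm.
apply: cube_norm; last by rewrite invr_ge0 ltW.
move=> i; rewrite leNgt; apply/negP => h; apply: w0.
apply/eqP; rewrite prodf_seq_eq0; apply/hasP; exists i => //=.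
  by rewrite mem_index_enum.
apply/eqP/hat_eq0; apply: ltW; move: h; rewrite !mxE.
rewrite (_ : l * _ - _ = l * (x ord0 i - ((m i)%:R - M%:R) / l)).
  by rewrite normrM gtr0_norm// -[l^-1]mul1r ltr_pdivrMr// mulrC.
by field; rewrite gt_eqF.
Qed.

(** A sum over multi-indices of products is the product over the coordinates of one-dimensional
    sums, each equal to 1. *)
Lemma sum_weight x : cube (M%:R / l) x -> \sum_m weight m x = 1.
Proof.
move=> xM; rewrite /weight.
rewrite -(bigA_distr_bigA (fun i (j : 'I_M.*2.+1) =>
  hat (l * x ord0 i - (j%:R - M%:R))))/=.
rewrite big1// => i _; rewrite sum_hat_eq1// normrM gtr0_norm//.
by rewrite mulrC -ler_pdivlMr.
Qed.

Lemma sum_fat_weight x : \sum_m fat_weight m x <= 3 ^+ n.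
Proof.
rewrite /fat_weight.
rewrite -(bigA_distr_bigA (fun i (j : 'I_M.*2.+1) =>
  fat (l * x ord0 i - (j%:R - M%:R))))/=.
rewrite -[in leRHS](card_ord n) -prodr_const.
apply: ler_prod => i _; rewrite sum_fat_le3 andbT.
by apply: sumr_ge0 => j _; exact: fat_ge0.
Qed.

(** The chain rule in the k-th factor costs l; the other factors are enlarged from [hat] to [fat],
    so that the sum of these bounds over all nodes is at most l C 3^n. *)
Lemma partial_weight_le (dh : R -> R) C m k x :
  (forall t, is_derive t (1 : R) hat (dh t)) -> 0 <= C ->
  (forall t, `|dh t| <= C * fat t) ->
  `|partial k (weight m) x| <= l * C * fat_weight m x.
Proof.
move=> dhE C0 dhC.
pose w i x := hat (l * x ord0 i - ((m i)%:R - M%:R)).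
rewrite (_ : weight m = fun x => w k x * \prod_(i < n | i != k) w i x); last first.
  by apply/funext => y; rewrite /weight (bigD1 k).
have dp y : differentiable (fun x => \prod_(i < n | i != k) w i x) y.
  under eq_fun do rewrite -big_filter.
  by apply: smooth_differentiable; apply: smooth_prod => i; exact: smooth_hat_coord.
rewrite partialM//; last exact: (smooth_differentiable _ (smooth_hat_coord m k)).
rewrite (@partial_indep (fun x => \prod_(i < n | i != k) w i x)); last first.
  move=> h; apply: eq_bigr => i ik; rewrite /w !mxE (negbTE ik) andbF mulr0 add0r//.
rewrite mulr0 add0r.
have [_ ->] := differentiable_fun_comp (dhE _)
  (smooth_differentiable x (smooth_scaled_coord m k)).
have -> : partial k (fun x => l * x ord0 k - ((m k)%:R - M%:R)) x = l.
  rewrite partialD; [|apply: smooth_differentiable..]; last 2 first.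
  - by apply: smoothM; [exact: smooth_cst|exact: smooth_coord].
  - exact: smooth_cst.
  rewrite partial_cst addr0 partialM; [|apply: smooth_differentiable..]; last 2 first.
  - exact: smooth_cst.
  - exact: smooth_coord.
  by rewrite partial_cst partial_coord eqxx mulr0 addr0 mulr1.
rewrite [in leRHS]/fat_weight [in leRHS](bigD1 k)//=.
rewrite normrM [`|dh _ * l|]normrM (gtr0_norm l0).
set A := `|\prod_(i < n | _) _|; set B := \prod_(i < n | _) _.
have AB : A <= B.
  rewrite /A ger0_norm; last by apply: prodr_ge0 => i _; exact: hat_ge0.
  by apply: ler_prod => i _; rewrite hat_ge0 hat_le_fat.
apply: (@le_trans _ _ (B * (C * fat (l * x ord0 k - ((m k)%:R - M%:R)) * l))).
  by apply: ler_pM => //; [exact: normr_ge0|rewrite mulr_ge0// ltW|rewrite ler_wpM2r// ltW].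
by rewrite le_eqVlt; apply/orP; left; apply/eqP; ring.
Qed.

End partition_of_unity.
End density.

Section density_theorem.
Context {R : realType} {n : nat}.
Implicit Types (x y z : 'rV[R]_n) (u v : 'rV[R]_n -> R).

Lemma continuous_bounded_cube u L : continuous u ->
  exists2 C, 0 <= C & forall x, cube L x -> `|u x| <= C.
Proof.
move=> cu; have cK : compact (u @` cube L).
  apply: continuous_compact; last exact: compact_cube.
  exact: continuous_subspaceT.
have [M [_ HM]] := compact_bounded cK.
exists (`|M| + 1); first by rewrite addr_ge0.
move=> x Lx; apply: HM; last by exists x.
by apply: (le_lt_trans (ler_norm _)); rewrite ltrDl.
Qed.

(** If neither point lies in the cube, both partial derivatives vanish; otherwise uniform continuity
    near the cube applies. The condition d <= 1 will keep the glued function supported within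
    distance 1 of the cube. *)
Lemma uniform_partials u L (e : R) : of_class_C 1 u ->
  (forall x, ~ cube L x -> u x = 0) -> 0 < e ->
  exists2 d, 0 < d <= 1 & forall i x y, `|x - y| <= d ->
    `|partial i u x - partial i u y| <= e.
Proof.
move=> [du pu] u0 e0.
have : \forall d \near (0 : R)^'+, 0 < d <= 1 /\ forall i x y, `|x - y| <= d ->
    `|partial i u x - partial i u y| <= e.
  near=> d; split.
    apply/andP; split; first by near: d; exact: nbhs_right_gt.
    by near: d; apply: nbhs_right_le.
  near: d; apply: filter_forall => i.
  have [d d0 dP] := uniformly_continuous_near_compact (@compact_cube R n L) (pu i) e0.
  near=> d' => x y xy.
  have xyd : `|x - y| <= d.
    by apply: (le_trans xy); near: d'; exact: nbhs_right_le.
  have [xL|xL] := pselect (cube L x); first exact: dP.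
  have [yL|yL] := pselect (cube L y); first by rewrite distrC; apply: dP; rewrite // distrC.
  by rewrite (partial_off_cube i u0 xL) (partial_off_cube i u0 yL) subrr normr0 ltW.
by move=> /filter_ex[d [? ?]]; exists d.
Unshelve. all: by end_near. Qed.

Definition cube_cutoff (L : R) x :=
  \prod_(i < n) (step (x ord0 i - L) * step (- x ord0 i - L)).

Lemma smooth_cube_cutoff L : smooth (cube_cutoff L).
Proof.
apply: smooth_prod => i; apply: smoothM; apply: smooth_step_comp.
  by apply: smoothD; [exact: smooth_coord|exact: smooth_cst].
under eq_fun do rewrite -mulN1r; apply: smoothD; last exact: smooth_cst.
by apply: smoothM; [exact: smooth_cst|exact: smooth_coord].
Qed.

Lemma cube_cutoff_ge0 L x : 0 <= cube_cutoff L x.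
Proof. by apply: prodr_ge0 => i _; rewrite mulr_ge0// step_ge0. Qed.


Lemma cube_cutoff1 L x : cube L x -> cube_cutoff L x = 1.
Proof.
move=> xL; apply: big1 => i _; have := xL i; rewrite ler_norml => /andP[? ?].
by rewrite !step1 ?mulr1//; lra.
Qed.

Lemma cube_cutoff0 L x : ~ cube (L + 1) x -> cube_cutoff L x = 0.
Proof.
move=> /existsNP[i /negP]; rewrite -ltNge ltr_normr => xi.
rewrite /cube_cutoff (bigD1 i)//=.
have [h|h] := orP xi; first by rewrite (step0 (t := x ord0 i - L)) ?mul0r//; lra.
by rewrite (step0 (t := - x ord0 i - L)) ?mulr0 ?mul0r//; lra.
Qed.

(** The glued polynomials may become slightly negative, whereas test functions must be nonnegative.
    Since their error is at most N e1, adding N e1 chi, with chi = 1 on [cube (L + 1)], restores the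
    sign and costs only another multiple of e1. *)
Lemma test_approximation u L : 0 <= L -> of_class_C 1 u -> (forall x, 0 <= u x) ->
  (forall x, ~ cube L x -> u x = 0) -> forall e, 0 < e ->
  exists phi, [/\ test_function phi, forall x, 0 <= phi x,
    forall x, ~ cube (L + 2) x -> phi x = 0,
    forall x, `|phi x - u x| <= e &
    forall i x, `|partial i phi x - partial i u x| <= e].
Proof.
move=> L0 uC u_ge0 u0 e e0; have [du pu] := uC.
have [dh dhE [C C0 dhC]] := @hat_derive R.
pose chi := cube_cutoff (L + 1).
have chi0 x : ~ cube (L + 2) x -> chi x = 0.
  by move=> xL; apply: cube_cutoff0; rewrite -addrA.
have sc : smooth chi by exact: smooth_cube_cutoff.
have [Cx Cx0 chi_le] := continuous_bounded_cube (L + 2) (sc 0%N).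
have [Dx Dx0 dchi_le] : exists2 D, 0 <= D & forall i x, `|partial i chi x| <= D.
  have H i : exists D, 0 <= D /\ forall x, `|partial i chi x| <= D.
    have [_ /(_ i) c1] := sc 1%N.
    have [D D0 HD] := continuous_bounded_cube (L + 2) c1.
    exists D; split=> // x.
    have [/HD//|xL] := pselect (cube (L + 2) x).
    by rewrite (partial_off_cube i chi0 xL) normr0.
  have [D HD] := choice H.
  exists (\sum_i D i); first by apply: sumr_ge0 => i _; case: (HD i).
  move=> i x; apply: (le_trans ((HD i).2 x)); rewrite (bigD1 i)//= lerDl.
  by apply: sumr_ge0 => j _; case: (HD j).
have {}chi_le x : chi x <= Cx.
  have [xL|xL] := pselect (cube (L + 2) x); last by rewrite chi0.
  by apply: (le_trans (ler_norm _)); exact: chi_le.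
pose N : R := n%:R.
have N0 : 0 <= N by exact: ler0n.
(* Collects the coefficients of e1 in both error bounds: N + N Cx for the values, C N 3^n + 1 + N Dx
   for the partial derivatives. *)
pose D := N + N * Cx + C * N * 3 ^+ n + 1 + N * Dx.
have D0 : 0 < D.
  by rewrite /D ltr_wpDr ?mulr_ge0// ltr_wpDl// !addr_ge0 ?mulr_ge0// exprn_ge0.
have [e1 e10 eE] : exists2 e1, 0 < e1 & e = e1 * D.
  by exists (e / D); [rewrite divr_gt0|rewrite divfK// gt_eqF].
have Ne1 : 0 <= N * e1 by rewrite mulr_ge0// ltW.
have [d /andP[d0 d1] ud] := uniform_partials uC u0 e10.
(* With mesh d, each weight lives within d of its node, where the Taylor estimate is valid. *)
pose l := d^-1.
have l0 : 0 < l by rewrite invr_gt0.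
(* Enough nodes for the weights to sum to 1 on a neighbourhood of [cube (L + 1)]. *)
pose M := Num.bound ((L + 2) * l).
have LM0 : (L + 2) * l < M%:R.
  by rewrite archi_boundP// mulr_ge0 ?addr_ge0// ltW.
have LM : L + 2 < M%:R / l by rewrite ltr_pdivlMr.
pose z := @node R n l M; pose w := @weight R n l M.
pose T m x := u (z m) + \sum_(i < n) partial i u (z m) * (x ord0 i - z m ord0 i).
have sT m : smooth (T m).
  apply: smoothD; first exact: smooth_cst.
  apply: smooth_sum => i; apply: smoothM; first exact: smooth_cst.
  by apply: smoothD; [exact: smooth_coord|exact: smooth_cst].
have pT m k x : partial k (T m) x = partial k u (z m).
  rewrite /T partialD; [|exact: smooth_differentiable (smooth_cst _)|]; last first.
    apply: smooth_differentiable; apply: smooth_sum => i.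
    apply: smoothM; first exact: smooth_cst.
    by apply: smoothD; [exact: smooth_coord|exact: smooth_cst].
  have sx i : smooth (fun x : 'rV[R]_n => x ord0 i - z m ord0 i).
    by apply: smoothD; [exact: smooth_coord|exact: smooth_cst].
  rewrite partial_cst add0r partial_sum; last first.
    move=> i; apply: smooth_differentiable; apply: smoothM => //; exact: smooth_cst.
  rewrite (bigD1 k)//= big1 ?addr0; last first.
    move=> i ik; rewrite partialM; [|exact: smooth_differentiable (smooth_cst _)|exact: smooth_differentiable].
    rewrite partial_cst mulr0 addr0 partialD; [|exact: smooth_differentiable (smooth_coord _)|exact: smooth_differentiable (smooth_cst _)].
    by rewrite partial_cst addr0 partial_coord eq_sym (negbTE ik) mulr0.
  rewrite partialM; [|exact: smooth_differentiable (smooth_cst _)|exact: smooth_differentiable].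
  rewrite partial_cst mulr0 addr0 partialD; [|exact: smooth_differentiable (smooth_coord _)|exact: smooth_differentiable (smooth_cst _)].
  by rewrite partial_cst addr0 partial_coord eqxx mulr1.
have w_off m x : ~ (`|x - z m| <= d) -> w m x = 0.
  by move=> /negP; rewrite -ltNge => h; apply: weight_eq0; rewrite // invrK.
have pw_off m k x : ~ (`|x - z m| <= d) -> partial k (w m) x = 0.
  move=> h; apply: (@partial_locally_cst _ _ _ (~` closed_ball_ Num.norm (z m) d) 0).
  - exact/closed_openC/closed_closed_ball_.
  - by move=> y yz; apply: w_off; rewrite distrC.
  - by rewrite /closed_ball_/= distrC.
have Terr m x : `|x - z m| <= d -> `|T m x - u x| <= N * e1 * d.
  move=> xz; rewrite distrC; apply: (le_trans (taylor_le (e := e1) du _ xz)).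
    by move=> i y; exact: ud.
  by rewrite ler_wpM2l// mulr_ge0// ltW.
pose P x := \sum_m w m x * T m x.
have sP : smooth P.
  by apply: smooth_sum => m; apply: smoothM; [exact: smooth_weight|exact: sT].
have P_off x : ~ cube (L + 1) x -> P x = 0.
  move=> xL; apply: big1 => m _.
  have [xz|/w_off ->] := pselect (`|x - z m| <= d); last by rewrite mul0r.
  (* A node within d <= 1 of x lies off the support of u, so its Taylor polynomial is 0. *)
  have zL : ~ cube L (z m).
    move=> zL; apply: xL => i; rewrite -(subrK (z m ord0 i) (x ord0 i)).
    apply: (le_trans (ler_normD _ _)); rewrite addrC lerD//.
    apply: (le_trans _ d1); apply: (le_trans _ xz).
    by have := coord_le_norm (x - z m) i; rewrite !mxE.
  rewrite /T u0// big1 ?addr0 ?mulr0// => i _.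
  by rewrite (partial_off_cube i u0 zL) mul0r.
have sw m : smooth (w m) by exact: smooth_weight.
have LM' x : cube (L + 1) x -> ball 0 (M%:R / l) x.
  rewrite -ball_normE/= sub0r normrN => xL.
  apply: (le_lt_trans _ LM); apply: (le_trans (cube_norm xL _)); lra.
have Perr x : `|P x - u x| <= N * e1.
  have [xL|xL] := pselect (cube (L + 1) x); last first.
    rewrite P_off// u0 ?subrr ?normr0//.
    by move=> xL'; apply: xL; apply: cube_le xL'; rewrite lerDl.
  have w1 : \sum_m w m x = 1.
    apply: sum_weight => //; apply: cube_le xL; apply: ltW.
    by apply: le_lt_trans LM; lra.
  rewrite -[u x]mul1r -w1 mulr_suml -sumrB.
  apply: (le_trans (ler_norm_sum _ _ _)).
  rewrite -[leRHS]mul1r -w1 mulr_suml; apply: ler_sum => m _.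
  have [xz|/w_off ->] := pselect (`|x - z m| <= d); last by rewrite !mul0r subrr normr0.
  rewrite -mulrBr normrM ger0_norm ?weight_ge0// ler_wpM2l ?weight_ge0//.
  apply: (le_trans (Terr _ _ xz)).
  by rewrite ler_piMr// mulr_ge0// ltW.
have dPerr k x : `|partial k P x - partial k u x| <= C * N * 3 ^+ n * e1 + e1.
  have [xL|xL] := pselect (cube (L + 1) x); last first.
    rewrite (partial_off_cube k P_off)// (partial_off_cube k u0).
      by rewrite subrr normr0 addr_ge0 ?mulr_ge0// ?exprn_ge0// ltW.
    by move=> xL'; apply: xL; apply: cube_le xL'; rewrite lerDl.
  have w1 y : ball 0 (M%:R / l) y -> \sum_m w m y = 1.
    rewrite -ball_normE/= sub0r normrN => yM.
    apply: sum_weight => // i; apply: (le_trans (coord_le_norm _ _)); exact: ltW.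
  have pw1 : \sum_m partial k (w m) x = 0.
    rewrite -partial_sum; last by move=> m; exact: smooth_differentiable.
    apply: (@partial_locally_cst _ _ _ (ball 0 (M%:R / l)) 1); last exact: LM'.
      apply: ball_open; apply: (lt_trans _ LM); exact: ltr_wpDl.
    exact: w1.
  rewrite partial_sum; last first.
    by move=> m; apply: smooth_differentiable; apply: smoothM.
  rewrite (eq_bigr (fun m => w m x * partial k u (z m) +
      T m x * partial k (w m) x)); last first.
    by move=> m _; rewrite partialM ?pT//; exact: smooth_differentiable.
  (* Since the derivatives of the weights sum to 0, u(x) may be subtracted from each T m x. Then T m
     x - u x = O(e1 d) compensates the factor l = 1/d in the derivatives of the weights. *)
  have -> : \sum_m (w m x * partial k u (z m) + T m x * partial k (w m) x) -
      partial k u x =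
      \sum_m w m x * (partial k u (z m) - partial k u x) +
      \sum_m (T m x - u x) * partial k (w m) x.
    have -> : \sum_m w m x * (partial k u (z m) - partial k u x) =
        \sum_m w m x * partial k u (z m) - partial k u x.
      under eq_bigr do rewrite mulrBr.
      by rewrite sumrB -mulr_suml (w1 _ (LM' _ xL)) mul1r.
    have -> : \sum_m (T m x - u x) * partial k (w m) x =
        \sum_m T m x * partial k (w m) x.
      under eq_bigr do rewrite mulrBl.
      by rewrite sumrB -mulr_sumr pw1 mulr0 subr0.
    by rewrite big_split/=; ring.
  apply: (le_trans (ler_normD _ _)); rewrite addrC; apply: lerD.
    apply: (le_trans (ler_norm_sum _ _ _)).
    apply: (@le_trans _ _ (\sum_m (N * e1 * d) * (l * C * fat_weight l m x))).
      apply: ler_sum => m _; rewrite normrM.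
      have pwC := partial_weight_le l0 m k x dhE C0 dhC.
      have [xz|xz] := pselect (`|x - z m| <= d).
        by apply: ler_pM => //; exact: Terr.
      rewrite (pw_off _ _ _ xz) normr0 mulr0 !mulr_ge0 ?fat_weight_ge0//; exact: ltW.
    rewrite -!mulr_sumr mulrA.
    rewrite (_ : N * e1 * d * (l * C) = C * N * e1 * (d * l)); last by ring.
    rewrite /l divff ?gt_eqF// mulr1.
    rewrite (_ : C * N * 3 ^+ n * e1 = C * N * e1 * 3 ^+ n); last by ring.
    apply: ler_wpM2l; last exact: sum_fat_weight.
    by rewrite -mulrA mulr_ge0.
  apply: (le_trans (ler_norm_sum _ _ _)).
  rewrite -[leRHS]mul1r -(w1 _ (LM' _ xL)) mulr_suml; apply: ler_sum => m _.
  have [xz|/w_off ->] := pselect (`|x - z m| <= d); last by rewrite !mul0r normr0.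
  rewrite normrM ger0_norm ?weight_ge0// ler_wpM2l ?weight_ge0//.
  by rewrite distrC; exact: ud.
pose phi x := P x + (N * e1) * chi x.
have schi : smooth (fun x => N * e1 * chi x).
  by apply: smoothM => //; exact: smooth_cst.
have sphi : smooth phi by exact: smoothD.
have phi0 x : ~ cube (L + 2) x -> phi x = 0.
  move=> xL; rewrite /phi chi0// mulr0 addr0 P_off// => xL'; apply: xL.
  by apply: cube_le xL'; lra.
exists phi; split=> //.
- exact: smooth_compact_test phi0.
- move=> x; rewrite /phi; have [xL|xL] := pselect (cube (L + 1) x).
    rewrite /chi cube_cutoff1// mulr1; have := Perr x; have := u_ge0 x.
    by rewrite ler_norml => ? /andP[? ?]; lra.
  by rewrite P_off// add0r mulr_ge0// cube_cutoff_ge0.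
- move=> x; rewrite /phi addrAC; apply: (le_trans (ler_normD _ _)).
  rewrite [`|_ * chi x|]ger0_norm; last by rewrite mulr_ge0// cube_cutoff_ge0.
  apply: (@le_trans _ _ (N * e1 + N * e1 * Cx)).
    by apply: lerD; [exact: Perr|rewrite ler_wpM2l].
  have h1 : 0 <= e1 * (C * N * 3 ^+ n) by rewrite !mulr_ge0 ?exprn_ge0// ltW.
  have h2 : 0 <= e1 * (N * Dx) by rewrite !mulr_ge0// ltW.
  rewrite eE /D; nra.
- move=> k x; rewrite /phi partialD; [|exact: smooth_differentiable..].
  rewrite partialM; [|exact: smooth_differentiable (smooth_cst _)|exact: smooth_differentiable].
  rewrite partial_cst mulr0 addr0 addrAC; apply: (le_trans (ler_normD _ _)).
  rewrite normrM ger0_norm//.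
  apply: (@le_trans _ _ (C * N * 3 ^+ n * e1 + e1 + N * e1 * Dx)).
    by apply: lerD; [exact: dPerr|rewrite ler_wpM2l].
  have h1 : 0 <= e1 * N by rewrite mulr_ge0// ltW.
  have h2 : 0 <= e1 * (N * Cx) by rewrite !mulr_ge0// ltW.
  rewrite eE /D; nra.
Qed.

End density_theorem.

(** * Integration of locally bounded functions *)

Section euclidean_theory.
Context {R : realType} {n : nat}.
Implicit Types (x y : 'rV[R]_n).

Lemma edot_self_ge0 x : 0 <= edot x x.
Proof. by apply: sumr_ge0 => i _; rewrite -expr2 sqr_ge0. Qed.

Lemma enorm_ge0 x : 0 <= enorm x.
Proof. exact: sqrtr_ge0. Qed.

Lemma sqr_enorm x : enorm x ^+ 2 = edot x x.
Proof. by rewrite sqr_sqrtr// edot_self_ge0. Qed.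

Lemma edotZl (c : R) x y : edot (c *: x) y = c * edot x y.
Proof. by rewrite /edot mulr_sumr; apply: eq_bigr => i _; rewrite mxE mulrA. Qed.

Lemma coord_le_enorm x i : `|x ord0 i| <= enorm x.
Proof.
rewrite -sqrtr_sqr ler_wsqrtr// /edot (bigD1 i)//= -expr2 lerDl.
by apply: sumr_ge0 => j _; rewrite -expr2 sqr_ge0.
Qed.

Lemma enorm_le_coord x (c : R) : 0 <= c -> (forall i, `|x ord0 i| <= c) ->
  enorm x <= n%:R * c.
Proof.
move=> c0 xc; rewrite -(ler_pXn2r (n := 2))// ?nnegrE ?enorm_ge0 ?mulr_ge0//.
rewrite sqr_enorm exprMn.
apply: (@le_trans _ _ (\sum_(i < n) c ^+ 2)).
  by apply: ler_sum => i _; rewrite -expr2 -real_normK ?num_real// ler_pXn2r// nnegrE.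
rewrite sumr_const card_ord -[leLHS]mulr_natl ler_wpM2r ?sqr_ge0//.
by rewrite -natrX ler_nat; case: (n) => // m; rewrite leq_pmulr.
Qed.

Lemma edot_le x y : `|edot x y| <= enorm x * enorm y.
Proof.
rewrite -(ler_pXn2r (n := 2))// ?nnegrE ?mulr_ge0 ?enorm_ge0//.
rewrite exprMn !sqr_enorm real_normK ?num_real//.
have [y0|y0] := eqVneq (edot y y) 0.
  have /eqP := y0; rewrite psumr_eq0; last by move=> i _; rewrite -expr2 sqr_ge0.
  move=> /allP yi; rewrite y0 mulr0 /edot big1 ?expr0n// => i _.
  have /(_ (mem_index_enum i)) := yi i.
  by rewrite /= mulf_eq0 orbb => /eqP ->; rewrite mulr0.
have yp : 0 < edot y y by rewrite lt_def y0 edot_self_ge0.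
pose c := edot x y / edot y y.
have : 0 <= edot (x - c *: y) (x - c *: y) by exact: edot_self_ge0.
have -> : edot (x - c *: y) (x - c *: y) =
    edot x x - 2 * c * edot x y + c ^+ 2 * edot y y.
  rewrite /edot !mulr_sumr -sumrB -big_split/=; apply: eq_bigr => i _.
  by rewrite !mxE; ring.
have -> : edot x x - 2 * c * edot x y + c ^+ 2 * edot y y =
    edot x x - edot x y ^+ 2 / edot y y by rewrite /c; field.
by rewrite subr_ge0 ler_pdivrMr.
Qed.

End euclidean_theory.

Section Linfty_loc_theory.
Context {R : realType} {n : nat}.
Implicit Types (x y : 'rV[R]_n) (u v g : 'rV[R]_n -> R).
Local Notation mu := (@lebesgue_rV R n).

#[global] Instance filter_ae_rV : Filter (nbhs (almost_everywhere mu)) :=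
  @ae_filter_ringOfSetsType _ _ _ mu.

Lemma Linfty_loc_continuous u : continuous u -> Linfty_loc u.
Proof.
move=> cu; split; first exact: continuous_lebesgue_measurable.
move=> K cK; have /compact_bounded[M [_ HM]] : compact (u @` K).
  by apply: continuous_compact => //; exact: continuous_subspaceT.
exists (`|M| + 1); apply: aeW => x Kx; apply: HM; last by exists x.
by apply: (le_lt_trans (ler_norm _)); rewrite ltrDl.
Qed.

Lemma Linfty_loc_cst (c : R) : Linfty_loc (fun _ : 'rV[R]_n => c).
Proof. by apply: Linfty_loc_continuous; exact: cst_continuous. Qed.

Lemma Linfty_locD u v : Linfty_loc u -> Linfty_loc v ->
  Linfty_loc (fun x => u x + v x).
Proof.
move=> [mu_ Hu] [mv Hv]; split; first exact: measurable_funD.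
move=> K cK; have [M HM] := Hu K cK; have [M' HM'] := Hv K cK.
exists (M + M'); apply: filterS2 HM HM' => x h1 h2 Kx.
by apply: (le_trans (ler_normD _ _)); apply: lerD; [exact: h1|exact: h2].
Qed.

Lemma Linfty_locM u v : Linfty_loc u -> Linfty_loc v ->
  Linfty_loc (fun x => u x * v x).
Proof.
move=> [mu_ Hu] [mv Hv]; split; first exact: measurable_funM.
move=> K cK; have [M HM] := Hu K cK; have [M' HM'] := Hv K cK.
exists (M * M'); apply: filterS2 HM HM' => x h1 h2 Kx.
by rewrite normrM; apply: ler_pM => //; [exact: h1|exact: h2].
Qed.

Lemma Linfty_loc_norm u : Linfty_loc u -> Linfty_loc (fun x => `|u x|).
Proof.
move=> [mu_ Hu]; split; first exact: measurableT_comp.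
move=> K cK; have [M HM] := Hu K cK.
by exists M; apply: filterS HM => x h Kx; rewrite normr_id; exact: h.
Qed.

Lemma Linfty_loc_sum (I : Type) (r : seq I) (F : I -> 'rV[R]_n -> R) :
  (forall i, Linfty_loc (F i)) -> Linfty_loc (fun x => \sum_(i <- r) F i x).
Proof.
move=> sF; elim: r => [|i r IH].
  by under eq_fun do rewrite big_nil; exact: Linfty_loc_cst.
by under eq_fun do rewrite big_cons; exact: Linfty_locD.
Qed.

Lemma Linfty_loc_powR u (r : R) : (forall x, 0 <= u x) -> 0 <= r ->
  Linfty_loc u -> Linfty_loc (fun x => u x `^ r).
Proof.
move=> u0 r0 [mu_ Hu]; split.
  exact: (measurableT_comp (@measurable_powR R r)).
move=> K cK; have [M HM] := Hu K cK.
exists (`|M| `^ r); apply: filterS HM => x h Kx.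
rewrite ger0_norm ?powR_ge0// ge0_ler_powR ?nnegrE//.
have := h Kx; rewrite ger0_norm// => /le_trans; apply; exact: ler_norm.
Qed.

Lemma measurable_cube (L : R) : measurable (cube L : set 'rV[R]_n).
Proof.
rewrite -[cube L]setCK; apply: measurableC; apply: open_measurable_rV.
exact/closed_openC/closed_cube.
Qed.

Lemma lebesgue_cube_fin (L : R) : (mu (cube L) < +oo)%E.
Proof.
apply: (@le_lt_trans _ _ ((`|L| - (- `|L|)) ^+ n)%:E); last exact: ltry.
have LL : - `|L| <= `|L| by rewrite ge0_cp.
rewrite -lebesgue_rV_box//; apply: le_outer_measure => x xL i.
by rewrite -ler_norml; apply: (le_trans (xL i)); exact: ler_norm.
Qed.

Lemma Linfty_loc_integrable u L : Linfty_loc u ->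
  (forall x, ~ cube L x -> u x = 0) -> mu.-integrable setT (EFin \o u).
Proof.
move=> [mu_ Hu] u0.
have mc : measurable (cube L : set (caratheodory_type ((@lebesgue_rV_borel R n)^*)%mu)).
  by apply: measurable_lebesgue; exact: measurable_cube.
have -> : EFin \o u = (EFin \o u) \_ (cube L).
  apply/funext => x; rewrite patchE; case: ifPn => // /negP xL.
  by rewrite /= u0// => xL'; apply: xL; rewrite inE.
have -> : [set: caratheodory_type ((@lebesgue_rV_borel R n)^*)%mu] = setT by [].
apply/(integrable_mkcond _ mc).
have [M HM] := Hu _ (@compact_cube R n L).
have mu1 : measurable_fun (cube L : set (caratheodory_type ((@lebesgue_rV_borel R n)^*)%mu)) u.
  exact: measurable_funTS.
apply/integrableP; split; first exact/measurable_EFinP.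
apply: le_lt_trans.
  apply: (@integral_le_bound _ _ _ _ _ _ `|M|%:E) => //.
  - exact/measurable_EFinP.
  - apply: filterS HM => x h Kx; rewrite /= lee_fin; apply: (le_trans (h Kx)).
    exact: ler_norm.
by rewrite lte_mul_pinfty// lebesgue_cube_fin.
Qed.

End Linfty_loc_theory.

Section Rintegral_ae.
Context d (T : measurableType d) (R : realType) (mu : {measure set T -> \bar R}).

(** The difference v - u agrees almost everywhere with its positive part, whose integral is
    nonnegative. *)
Lemma ae_le_Rintegral (D : set T) (u v : T -> R) : measurable D ->
  mu.-integrable D (EFin \o u) -> mu.-integrable D (EFin \o v) ->
  {ae mu, forall x, D x -> u x <= v x} ->
  \int[mu]_(x in D) u x <= \int[mu]_(x in D) v x.
Proof.
move=> mD iu iv uv.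
have iw : mu.-integrable D (EFin \o (fun x => v x - u x)).
  exact: (integrableB mD iv iu).
rewrite -subr_ge0 -RintegralB// /Rintegral.
rewrite (@ae_eq_integral _ _ _ mu D
    (fun x => (Num.max (v x - u x) 0)%:E) (fun x => (v x - u x)%:E))//.
- by apply: fine_ge0; apply: integral_ge0 => x _; rewrite lee_fin le_max lexx orbT.
- by case/integrableP : iw.
- apply/measurable_EFinP; apply: measurable_funrpos.
  by apply/measurable_EFinP; case/integrableP : iw.
- apply: filterS uv => x /= h Dx; congr EFin.
  by rewrite max_l// subr_ge0 h.
Qed.

End Rintegral_ae.

(** * C^1 test functions *)

Section C1_test_functions.
Context {R : realType} {n : nat}.
Implicit Types (x y : 'rV[R]_n) (u v g : 'rV[R]_n -> R).
Local Notation mu := (@lebesgue_rV R n).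

Lemma continuous_enorm_gradient u : of_class_C 1 u ->
  continuous (fun x => enorm (gradient u x)).
Proof.
move=> [du pu] x.
have c : continuous (fun x => edot (gradient u x) (gradient u x)).
  apply: (@of_class_C_sum R n 0) => i.
  by apply: of_class_CM; under eq_fun do rewrite mxE; exact: pu.
exact: (cvg_comp _ _ (c x) (@sqrt_continuous R _)).
Qed.

(** For p < 2 the factor |Du|^(p-2) may be unbounded near critical points; only its product with Du
    is controlled, by |Du|^(p-1). *)
Lemma Linfty_loc_p_flux p u i : 1 < p -> of_class_C 1 u ->
  Linfty_loc (fun x => p_flux p u x ord0 i).
Proof.
move=> p1 uC; have cG := continuous_enorm_gradient uC.
have [du pu] := uC.
split.
  rewrite (_ : (fun x => _) =
      fun x => enorm (gradient u x) `^ (p - 2) * partial i u x); last first.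
    by apply/funext => x; rewrite /p_flux !mxE.
  apply: measurable_funM.
    apply: (measurableT_comp (@measurable_powR R (p - 2))).
    exact: continuous_lebesgue_measurable.
  exact/continuous_lebesgue_measurable/pu.
move=> K cK.
have [_ /(_ K cK)[M HM]] : Linfty_loc (fun x => enorm (gradient u x) `^ (p - 1)).
  apply: Linfty_loc_powR; [by move=> x; exact: enorm_ge0|lra|].
  exact: Linfty_loc_continuous.
exists M; apply: filterS HM => x h Kx; apply: le_trans (h Kx).
rewrite [leRHS]ger0_norm ?powR_ge0// /p_flux mxE normrM (ger0_norm (powR_ge0 _ _)).
apply: (le_trans (ler_wpM2l (powR_ge0 _ _) (coord_le_enorm _ _))).
have [->|G0] := eqVneq (enorm (gradient u x)) 0; first by rewrite mulr0 powR_ge0.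
rewrite -{2}[enorm _]powRr1 ?enorm_ge0// -powRD; last by rewrite G0 implybT.
by rewrite (_ : p - 2 + 1 = p - 1)//; ring.
Qed.

Lemma edot_gradientE p u v x : edot (p_flux p u x) (gradient v x) =
  \sum_(i < n) p_flux p u x ord0 i * partial i v x.
Proof. by apply: eq_bigr => i _; rewrite [gradient v x ord0 i]mxE. Qed.

Lemma Linfty_loc_weak_form p u g v : 1 < p -> of_class_C 1 u -> Linfty_loc g ->
  of_class_C 1 v ->
  Linfty_loc (fun x => edot (p_flux p u x) (gradient v x)) /\
  Linfty_loc (fun x => g x * v x).
Proof.
move=> p1 uC gL vC; split.
  under eq_fun do rewrite edot_gradientE.
  apply: Linfty_loc_sum => i; apply: Linfty_locM; first exact: Linfty_loc_p_flux.
  by apply: Linfty_loc_continuous; case: vC => _; exact.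
apply: (Linfty_locM gL); apply: Linfty_loc_continuous.
by move=> x; apply: differentiable_continuous; case: vC.
Qed.

Lemma weak_form_off_cube p u g v L x : (forall x, ~ cube L x -> v x = 0) ->
  ~ cube L x -> edot (p_flux p u x) (gradient v x) = 0 /\ g x * v x = 0.
Proof.
move=> v0 xL; split; last by rewrite v0// mulr0.
by rewrite edot_gradientE big1// => i _; rewrite (partial_off_cube i v0)// mulr0.
Qed.

(* Smooth functions being dense in [C^1_c] for the [C^1] norm, the inequality
   extends from smooth to [C^1] test functions. *)
Lemma p_laplacian_ge_C1 p u g v L : 1 < p -> of_class_C 1 u -> Linfty_loc g ->
  p_laplacian_ge p u g -> 0 <= L -> of_class_C 1 v -> (forall x, 0 <= v x) ->
  (forall x, ~ cube L x -> v x = 0) ->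
  \int[mu]_x (edot (p_flux p u x) (gradient v x) + g x * v x) <= 0.
Proof.
move=> p1 uC gL up L0 vC v_ge0 v0.
(* If phi and its partial derivatives are within e' of those of v, the two integrands differ by at
   most e' S; the cutoff in S makes it integrable. Then e' = e / (|B| + 1) makes the total error at
   most e. *)
pose S x := ((\sum_(i < n) `|p_flux p u x ord0 i|) + `|g x|) * cube_cutoff (L + 2) x.
have SL : Linfty_loc S.
  apply: Linfty_locM.
    apply: Linfty_locD; last exact: Linfty_loc_norm.
    by apply: Linfty_loc_sum => i; apply: Linfty_loc_norm; exact: Linfty_loc_p_flux.
  exact: Linfty_loc_continuous (smooth_cube_cutoff (L + 2) 0%N).
have Si : mu.-integrable setT (EFin \o S).
  apply: (@Linfty_loc_integrable _ _ _ (L + 2 + 1)) => // x xL.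
  by rewrite /S cube_cutoff0// mulr0.
have intW w L' : of_class_C 1 w -> (forall x, ~ cube L' x -> w x = 0) ->
    mu.-integrable setT (EFin \o (fun x => edot (p_flux p u x) (gradient w x))) /\
    mu.-integrable setT (EFin \o (fun x => g x * w x)).
  move=> wC w0; have [h1 h2] := Linfty_loc_weak_form p1 uC gL wC.
  by split; apply: (@Linfty_loc_integrable _ _ _ L') => // x xL;
    have [] := weak_form_off_cube p u g w0 xL.
have iD (f1 f2 : 'rV[R]_n -> R) : mu.-integrable setT (EFin \o f1) ->
    mu.-integrable setT (EFin \o f2) ->
    mu.-integrable setT (EFin \o (fun x => f1 x + f2 x)).
  by move=> h1 h2; exact: (integrableD measurableT h1 h2).
have [iv1 iv2] := intW v L vC v0.
apply/ler_addgt0Pr => e e0; rewrite add0r.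
pose B := \int[mu]_x S x.
pose e' := e / (`|B| + 1).
have B1 : 0 < `|B| + 1 by rewrite ltr_wpDl.
have e'0 : 0 < e' by rewrite divr_gt0.
have [phi [tphi phi_ge0 phi0 phiv dphiv]] := test_approximation L0 vC v_ge0 v0 e'0.
have [ip1 ip2] := intW phi (L + 2) (tphi.1 1%N) phi0.
have phi_le0 : \int[mu]_x (edot (p_flux p u x) (gradient phi x) + g x * phi x) <= 0.
  rewrite (RintegralD measurableT ip1 ip2) -lee_fin EFinD.
  rewrite /Rintegral !fineK; first exact: up.
  - exact: integrable_fin_num.
  - exact: integrable_fin_num.
have eS : mu.-integrable setT (EFin \o (fun x => e' * S x)).
  exact: (integrableZl measurableT e' Si).
apply: (@le_trans _ _ (\int[mu]_x ((edot (p_flux p u x) (gradient phi x) +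
    g x * phi x) + e' * S x))).
  apply: (@le_Rintegral _ _ _ mu _ _ _ measurableT (iD _ _ iv1 iv2)
    (iD _ _ (iD _ _ ip1 ip2) eS)) => x _.
  have [xL|xL] := pselect (cube (L + 2) x); last first.
    have [-> ->] := weak_form_off_cube p u g phi0 xL.
    have xL' : ~ cube L x by move=> h; apply: xL; apply: cube_le h; rewrite lerDl.
    have [-> ->] := weak_form_off_cube p u g v0 xL'.
    rewrite !add0r; apply: mulr_ge0; first exact: ltW.
    apply: mulr_ge0; last exact: cube_cutoff_ge0.
    by apply: addr_ge0 => //; exact: sumr_ge0.
  rewrite /S cube_cutoff1// mulr1 mulrDr addrACA; apply: lerD; last first.
    rewrite -lerBlDl -mulrBr; apply: (le_trans (ler_norm _)).
    by rewrite normrM mulrC ler_wpM2r// distrC.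
  rewrite !edot_gradientE mulr_sumr -big_split/=; apply: ler_sum => i _.
  rewrite -lerBlDl -mulrBr; apply: (le_trans (ler_norm _)).
  by rewrite normrM mulrC ler_wpM2r// distrC.
rewrite (RintegralD measurableT (iD _ _ ip1 ip2) eS) (RintegralZl _ measurableT Si).
rewrite -[leRHS]add0r; apply: lerD => //; rewrite -/B /e' mulrAC ler_pdivrMr//.
apply: ler_wpM2l; first exact: ltW.
by apply: (le_trans (ler_norm _)); rewrite lerDl.
Qed.

End C1_test_functions.

(** * The vanishing argument *)

Section real_lemmas.
Context {R : realType}.

Lemma powR_split (x t : R) : 0 <= x -> 0 < t < 1 -> x `^ (1 - t) * x `^ t = x.
Proof.
move=> x0 /andP[t0 t1]; have [->|xn0] := eqVneq x 0.
  by rewrite (powR0 (x := t)) ?mulr0// gt_eqF.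
by rewrite -powRD ?xn0 ?implybT// subrK powRr1.
Qed.

(** If y <= s x, replacing y by s x leaves a multiple of x; otherwise replacing x by y/s leaves a
    multiple of y. The threshold s is fixed by s^t = e / (K + 1), where K + 1 covers K = 0. *)
Lemma young_powR (K t e : R) : 0 < t < 1 -> 0 <= K -> 0 < e ->
  exists2 C, 0 <= C & forall x y, 0 <= x -> 0 <= y ->
    K * (x `^ (1 - t) * y `^ t) <= e * x + C * y.
Proof.
move=> t01 K0 e0; have /andP[t0 t1] := t01.
have K1 : 0 < K + 1 by rewrite ltr_wpDl.
pose s := (e / (K + 1)) `^ t^-1.
have s0 : 0 < s by rewrite /s; apply: powR_gt0; rewrite divr_gt0.
have st : s `^ t = e / (K + 1).
  by rewrite /s -powRrM mulVf ?gt_eqF// powRr1// ltW// divr_gt0.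
exists (K * s^-1 `^ (1 - t)); first by rewrite mulr_ge0 ?powR_ge0.
move=> x y x0 y0; have [yx|xy] := leP y (s * x).
  apply: (@le_trans _ _ (e * x)); last first.
    by rewrite lerDl !mulr_ge0 ?powR_ge0.
  apply: (@le_trans _ _ (K * (x `^ (1 - t) * (s * x) `^ t))).
    rewrite !ler_wpM2l ?powR_ge0// ge0_ler_powR ?nnegrE ?(ltW t0)//.
    by rewrite mulr_ge0// ltW.
  rewrite powRM ?(ltW s0)// st.
  rewrite (_ : _ * (_ * _) = e * (K / (K + 1)) * (x `^ (1 - t) * x `^ t)); last by ring.
  rewrite powR_split// ler_wpM2r// ger_pMr//.
  by rewrite ler_pdivrMr// mul1r lerDl.
apply: (@le_trans _ _ (K * s^-1 `^ (1 - t) * y)); last first.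
  by rewrite lerDr mulr_ge0// ltW.
apply: (@le_trans _ _ (K * ((s^-1 * y) `^ (1 - t) * y `^ t))).
  rewrite ler_wpM2l// ler_wpM2r ?powR_ge0// ge0_ler_powR ?nnegrE//.
  - by rewrite subr_ge0 ltW.
  - by rewrite mulr_ge0// invr_ge0 ltW.
  - by rewrite ler_pdivlMl// ltW.
rewrite powRM ?invr_ge0 ?(ltW s0)// -[_ * y `^ t]mulrA powR_split//.
by rewrite mulrA.
Qed.

(** If the supremum L were positive, take r0 with J(r0) > L - eta and use the inequality at 2 r0:
    the difference J(4 r0) - J(r0) is below eta, hence J(2 r0) <= C eta + L/4, which is less than
    J(r0) <= J(2 r0). *)
Lemma hole_filling (J : R -> R) (R1 B : R) : 0 < R1 ->
  (forall s r, 0 < s -> 2 * s <= r -> J s <= J r) ->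
  (forall r, R1 <= r -> J r <= B) ->
  (forall d, 0 < d -> exists2 C, 0 <= C & forall r, R1 <= r ->
     J r <= C * (J (2 * r) - J (r / 2)) + d) ->
  forall r, R1 <= r -> J r <= 0.
Proof.
move=> R10 Jmono JB Jhole r1 r1R; rewrite leNgt; apply/negP => J0.
pose A := [set J r | r in [set r | R1 <= r]].
have supA : has_sup A.
  split; first by exists (J r1), r1.
  by exists B => _ [r rR <-]; exact: JB.
have JL r : R1 <= r -> J r <= sup A.
  by move=> rR; apply: (ub_le_sup supA.2); exists r.
set L := sup A in JL.
have L0 : 0 < L by apply: lt_le_trans (JL _ r1R).
have [C C0 HC] := Jhole (L / 4) ltac:(lra).
(* Chosen so that C eta + L/4 = L/2 - eta < L - eta. *)
pose eta := L / (4 * (C + 1)).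
have C1 : 0 < C + 1 by lra.
have eta0 : 0 < eta by rewrite divr_gt0// mulr_gt0.
have etaE : eta * (C + 1) = L / 4 by rewrite /eta; field; rewrite gt_eqF.
have [_ [r0 /= r0R <-] Jr0] := sup_adherent eta0 supA.
have r00 : 0 < r0 by exact: lt_le_trans r0R.
have := HC (2 * r0) ltac:(lra).
have -> : 2 * r0 / 2 = r0 by field.
have : J (2 * (2 * r0)) <= L by apply: JL; lra.
have : J r0 <= J (2 * r0) by apply: Jmono.
rewrite -/L in Jr0.
move=> h1 h2 h3.
have h4 : C * (J (2 * (2 * r0)) - J r0) <= C * eta by rewrite ler_wpM2l//; lra.
have h5 : C * eta = L / 4 - eta by rewrite -etaE; ring.
have h6 : eta <= L / 4 by rewrite -etaE; nra.
lra.
Qed.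

End real_lemmas.

Section vanishing.
Context {R : realType} {n : nat}.
Local Notation mu := (@lebesgue_rV R n).
Implicit Types (x : 'rV[R]_n).

Variable psi : R -> 'rV[R]_n -> R.
Hypothesis psi_cont : forall r, continuous (psi r).
Hypothesis psi01 : forall r x, 0 <= psi r x <= 1.
Hypothesis psi1 : forall r x, 0 < r -> enorm x <= r -> psi r x = 1.
Hypothesis psi0 : forall r x, 0 < r -> 2 * r <= enorm x -> psi r x = 0.

Variables (Y : 'rV[R]_n -> R) (X Z : R -> 'rV[R]_n -> R) (K t M0 R1 : R).
Hypothesis R10 : 0 < R1.
Hypothesis t01 : 0 < t < 1.
Hypothesis K0 : 0 <= K.
Hypothesis YL : Linfty_loc Y.
Hypothesis Y0 : {ae mu, forall x, 0 <= Y x}.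
Hypothesis X0 : forall r x, 0 <= X r x.
Hypothesis mX : forall r, lebesgue_measurable_fun (X r).
Hypothesis XM : forall r, R1 <= r ->
  (\int[mu]_(x in annulus r) (X r x)%:E <= M0%:E)%E.
Hypothesis Zi : forall r, R1 <= r -> mu.-integrable setT (EFin \o Z r).
Hypothesis Zle0 : forall r, R1 <= r -> \int[mu]_x Z r x <= 0.
Hypothesis YZ : forall r, R1 <= r -> {ae mu, forall x,
  Y x * psi r x <= Z r x +
    (if x \in annulus r then
       K * ((Y x * psi r x) `^ (1 - t) * X r x `^ t) else 0)}.

Let J r := \int[mu]_x (Y x * psi r x).

Lemma enorm_coord_cube x (r : R) : enorm x <= r -> cube r x.
Proof. by move=> xr i; apply: le_trans xr; exact: coord_le_enorm. Qed.

Lemma Ypsi_integrable r : 0 < r ->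
  mu.-integrable setT (EFin \o (fun x => Y x * psi r x)).
Proof.
move=> r0; apply: (@Linfty_loc_integrable _ _ _ (2 * r)).
  exact: (Linfty_locM YL (Linfty_loc_continuous (@psi_cont r))).
move=> x xr; rewrite psi0 ?mulr0//; rewrite leNgt; apply/negP => h; apply: xr.
exact/enorm_coord_cube/ltW.
Qed.

Lemma enorm_continuous : continuous (fun x : 'rV[R]_n => enorm x).
Proof.
move=> x; have c : continuous (fun x : 'rV[R]_n => edot x x).
  apply: (@of_class_C_sum R n 0) => i.
  by apply: of_class_CM; exact: (smooth_coord i 0%N).
exact: (cvg_comp _ _ (c x) (@sqrt_continuous R _)).
Qed.

Lemma measurable_annulus r :
  measurable (annulus r : set (caratheodory_type ((@lebesgue_rV_borel R n)^*)%mu)).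
Proof.
apply: measurable_lebesgue.
rewrite (_ : annulus r = ~` ([set x : 'rV[R]_n | enorm x < r] `|`
    [set x : 'rV[R]_n | 2 * r < enorm x])).
  apply: measurableC; apply: measurableU; apply: open_measurable_rV.
    apply: (@open_comp _ _ (@enorm R n) [set s | s < r]).
      by move=> x _; exact: enorm_continuous.
    exact: open_lt.
  apply: (@open_comp _ _ (@enorm R n) [set s | 2 * r < s]).
    by move=> x _; exact: enorm_continuous.
  exact: open_gt.
rewrite setCU; apply/seteqP; split=> x /= [h1 h2].
  by split; apply/negP; rewrite -leNgt.
by split; rewrite leNgt; apply/negP.
Qed.

(** Integrating [YZ], the weak form [Z] contributes at most 0. Young's inequality enters as a
    hypothesis, so that either of its two coefficients can later be made small. *)
Let annulus_integral_le r (e C : R) : 0 <= e -> 0 <= C -> R1 <= r ->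
  (forall c d, 0 <= c -> 0 <= d ->
    K * (c `^ (1 - t) * d `^ t) <= e * c + C * d) ->
  J r <= e * \int[mu]_(x in annulus r) (Y x * psi r x) + C * M0.
Proof.
move=> e0 C0 rR H.
have r0 : 0 < r by exact: lt_le_trans rR.
have mA := measurable_annulus r.
have Xi : mu.-integrable (annulus r) (EFin \o X r).
  apply/integrableP; split.
    by apply/measurable_EFinP; exact: measurable_funTS.
  apply: (@le_lt_trans _ _ M0%:E); last exact: ltry.
  apply: le_trans (XM rR); rewrite le_eqVlt; apply/orP; left; apply/eqP.
  by apply: eq_integral => x _ /=; rewrite ger0_norm.
have Yi : mu.-integrable (annulus r) (EFin \o (fun x => Y x * psi r x)).
  exact: (integrableS measurableT mA (@subsetT _ _) (Ypsi_integrable r0)).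
have eYi : mu.-integrable (annulus r) (EFin \o (fun x => e * (Y x * psi r x))).
  exact: (integrableZl mA e Yi).
have CXi : mu.-integrable (annulus r) (EFin \o (fun x => C * X r x)).
  exact: (integrableZl mA C Xi).
pose F x := e * (Y x * psi r x) + C * X r x.
have Fi : mu.-integrable (annulus r) (EFin \o F) by exact: (integrableD mA eYi CXi).
have FAi : mu.-integrable setT (EFin \o (F \_ (annulus r))).
  rewrite (_ : EFin \o _ = (EFin \o F) \_ (annulus r)).
    exact: (integrable_mkcond _ mA).1.
  by apply/funext => x; rewrite /= !patchE; case: ifP.
have ZFi : mu.-integrable setT (EFin \o (fun x => Z r x + (F \_ (annulus r)) x)).
  exact: (integrableD measurableT (Zi rR) FAi).
apply: (@le_trans _ _ (\int[mu]_x (Z r x + (F \_ (annulus r)) x))).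
  apply: (ae_le_Rintegral measurableT (Ypsi_integrable r0) ZFi).
  apply: filterS2 Y0 (YZ rR) => x Yx h _; apply: (le_trans h).
  rewrite lerD2l patchE; case: ifPn => // _; apply: H => //.
  by rewrite mulr_ge0//; case/andP : (psi01 r x).
rewrite (RintegralD measurableT (Zi rR) FAi) -Rintegral_mkcond.
rewrite (RintegralD mA eYi CXi) !RintegralZl//.
rewrite -[leRHS]add0r; apply: lerD; first exact: Zle0.
rewrite lerD2l ler_wpM2l// /Rintegral -lee_fin fineK; first exact: XM.
exact: integrable_fin_num.
Qed.

(** Radii have to be doubled: psi_s vanishes off B_(2s), and psi_r = 1 on this ball when 2s <= r. *)
Let J_mono s r : 0 < s -> 2 * s <= r -> J s <= J r.
Proof.
move=> s0 sr; have r0 : 0 < r by lra.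
apply: (ae_le_Rintegral measurableT (Ypsi_integrable s0) (Ypsi_integrable r0)).
apply: filterS Y0 => x Yx _; rewrite ler_wpM2l//.
have [xr|xr] := leP (enorm x) r.
  by rewrite [leRHS]psi1//; case/andP : (psi01 s x).
rewrite [leLHS]psi0//; first by case/andP : (psi01 r x).
by apply: (le_trans sr); exact: ltW.
Qed.

(** On the annulus psi_(2r) = 1, because |x| <= 2r, and psi_(r/2) = 0, because |x| >= 2(r/2).
    Elsewhere psi_(2r) >= psi_(r/2). *)
Let annulus_le_J r : 0 < r ->
  \int[mu]_(x in annulus r) (Y x * psi r x) <= J (2 * r) - J (r / 2).
Proof.
move=> r0; have r20 : 0 < r / 2 by rewrite divr_gt0.
have r2 : 0 < 2 * r by rewrite mulr_gt0.
have mA := measurable_annulus r.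
rewrite -(RintegralB measurableT (Ypsi_integrable r2) (Ypsi_integrable r20)).
rewrite Rintegral_mkcond.
apply: (ae_le_Rintegral measurableT).
- rewrite (_ : EFin \o _ = (EFin \o (fun x => Y x * psi r x)) \_ (annulus r)).
    apply: (integrable_mkcond _ mA).1.
    exact: (integrableS measurableT mA (@subsetT _ _) (Ypsi_integrable r0)).
  by apply/funext => x; rewrite /= !patchE; case: ifP.
- exact: (integrableB measurableT (Ypsi_integrable r2) (Ypsi_integrable r20)).
apply: filterS Y0 => x Yx _; rewrite patchE -mulrBr; case: ifPn => [|_].
  rewrite inE => -[h1 h2]; rewrite ler_wpM2l// (psi1 r2)// (psi0 r20)//.
    by rewrite subr0; case/andP : (psi01 r x).
  by rewrite mulrC divfK.
rewrite mulr_ge0// subr_ge0; have [xr|xr] := leP (enorm x) (2 * r).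
  by rewrite [leRHS]psi1//; case/andP : (psi01 (r / 2) x).
rewrite [leLHS]psi0//; first by case/andP : (psi01 (2 * r) x).
by rewrite mulrC divfK//; lra.
Qed.

Lemma vanishing r : R1 <= r -> \int[mu]_x (Y x * psi r x) <= 0.
Proof.
have M0_ge0 : 0 <= M0.
  rewrite -lee_fin; apply: le_trans (XM (lexx R1)).
  by apply: integral_ge0 => x _; rewrite lee_fin.
have half0 : 0 < 2^-1 :> R by rewrite invr_gt0.
(* First use: with coefficient 1/2 on Y psi_r, half of J(r) is absorbed and J(r) <= 2 C M0. *)
have [C C0 HC] := young_powR t01 K0 half0.
apply: (@hole_filling _ J R1 (2 * (C * M0))) => //.
- move=> {}r rR; have r0 : 0 < r by exact: lt_le_trans rR.
  have := annulus_integral_le (ltW half0) C0 rR HC.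
  have : \int[mu]_(x in annulus r) (Y x * psi r x) <= J r.
    rewrite Rintegral_mkcond; have mA := measurable_annulus r.
    apply: (ae_le_Rintegral measurableT _ (Ypsi_integrable r0)).
      rewrite (_ : EFin \o _ = (EFin \o (fun x => Y x * psi r x)) \_ (annulus r)).
        apply: (integrable_mkcond _ mA).1.
        exact: (integrableS measurableT mA (@subsetT _ _) (Ypsi_integrable r0)).
      by apply/funext => x; rewrite /= !patchE; case: ifP.
    apply: filterS Y0 => x Yx _; rewrite patchE; case: ifPn => // _.
    by rewrite mulr_ge0//; case/andP : (psi01 r x).
  lra.
- move=> d d0.
  have t01' : 0 < 1 - t < 1 by have /andP[? ?] := t01; apply/andP; split; lra.
  have M1 : 0 < M0 + 1 by rewrite ltr_wpDl.
  (* Second use, with the roles exchanged: the small coefficient falls on X_r, whose integral is at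
     most M0, so that it costs at most d. *)
  have [C' C'0 HC'] := young_powR t01' K0 (divr_gt0 d0 M1).
  exists C' => // {}r rR; have r0 : 0 < r by exact: lt_le_trans rR.
  have e0 : 0 <= d / (M0 + 1) by rewrite divr_ge0// ltW.
  apply: (@le_trans _ _ (C' * \int[mu]_(x in annulus r) (Y x * psi r x) +
      d / (M0 + 1) * M0)).
    apply: annulus_integral_le => // c c' c0 c'0.
    have := HC' c' c c'0 c0; rewrite opprB [1 + _]addrC subrK.
    by rewrite [c' `^ _ * _]mulrC [X in _ <= X]addrC.
  apply: lerD; first by rewrite ler_wpM2l// annulus_le_J.
  by rewrite mulrAC ler_pdivrMr// ler_wpM2l ?(ltW d0)// lerDl.
Qed.

(** By [vanishing], Y psi_r = 0 almost everywhere. The unit cube Q is translated so far that Y > 0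
    almost everywhere on it, and r is so large that psi_r = 1 on it; Q would then be negligible. *)
Lemma vanishing_contradiction R2 : (0 < n)%N ->
  {ae mu, forall x, R2 <= enorm x -> 0 < Y x} -> False.
Proof.
move=> n0 Ypos; pose i0 := Ordinal n0.
pose s := Num.max R2 0.
have s0 : 0 <= s by rewrite /s le_max lexx orbT.
have s1 : s <= s + 1 by rewrite lerDl.
pose Q := [set x : 'rV[R]_n | forall i, s <= x ord0 i <= s + 1].
have muQ : mu Q = 1%E.
  by rewrite lebesgue_rV_box// addrAC subrr add0r expr1n.
pose r := Num.max R1 (n%:R * (s + 1)).
have rR : R1 <= r by rewrite le_max lexx.
have r0 : 0 < r by exact: lt_le_trans rR.
have Qr x : Q x -> R2 <= enorm x /\ psi r x = 1.
  move=> Qx; split.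
    apply: (le_trans _ (coord_le_enorm x i0)).
    apply: (@le_trans _ _ s); first by rewrite le_max lexx.
    by have /andP[h _] := Qx i0; apply: (le_trans h); exact: ler_norm.
  apply: psi1 => //; rewrite le_max; apply/orP; right.
  apply: enorm_le_coord; first by rewrite addr_ge0.
  by move=> i; have /andP[h1 h2] := Qx i; rewrite ger0_norm// (le_trans s0).
have Yi := Ypsi_integrable r0.
have /integrableP[mY _] := Yi.
have aeY : ae_eq mu setT (EFin \o (fun x => Y x * psi r x)) (cst 0%E).
  apply/(ae_eq_integral_abs mu measurableT mY).
  apply/eqP; rewrite eq_le integral_ge0 ?andbT; last by move=> *; exact: abse_ge0.
  have /integrableP[mYa _] := integrable_abse Yi.
  have -> := @ae_eq_integral _ _ _ mu setT (EFin \o (fun x => Y x * psi r x))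
    (abse \o (EFin \o (fun x => Y x * psi r x))) measurableT mYa mY.
    have := vanishing rR; rewrite /Rintegral -lee_fin fineK; first by [].
    exact: integrable_fin_num.
  apply: filterS Y0 => x Yx _ /=; rewrite ger0_norm// mulr_ge0//.
  by case/andP : (psi01 r x).
have [N [mN N0 QN]] : mu.-negligible Q.
  have : {ae mu, forall x, ~ Q x}.
    apply: filterS2 Ypos aeY => x h1 h2 /Qr[h3 h4].
    have := h2 I; rewrite /= h4 mulr1 => -[Yx0].
    by have := h1 h3; rewrite Yx0 ltxx.
  by apply: negligibleS => x Qx; exact.
have : (mu Q <= mu N)%E by exact: le_outer_measure.
by rewrite muQ N0 leNgt lte01.
Qed.

End vanishing.

(** * Cutoffs on annuli *)

Section cutoff.
Context {R : realType} {n : nat}.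
Implicit Types (x : 'rV[R]_n).

(** The argument of [step] is 0 at |x| = r and 1 at |x| = 2r; the squared norm keeps it smooth at
    the origin. *)
Definition cutoff_base (r : R) x : R := step ((edot x x / r ^+ 2 - 1) / 3).

(** The m-th power makes the gradient vanish together with the cutoff, at the rate psi^(1-1/m). *)
Definition cutoff (m : nat) (r : R) x : R := cutoff_base r x ^+ m.

Let arg (r : R) x : R := (edot x x / r ^+ 2 - 1) / 3.

Let smooth_arg r : smooth (arg r).
Proof.
apply: smoothM; last exact: smooth_cst.
apply: smoothD; last exact: smooth_cst.
apply: smoothM; last exact: smooth_cst.
by apply: smooth_sum => i; apply: smoothM; exact: smooth_coord.
Qed.

Lemma smooth_cutoff m r : smooth (cutoff m r).
Proof. exact/smoothX/smooth_step_comp/smooth_arg. Qed.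

Lemma cutoff_base01 r x : 0 <= cutoff_base r x <= 1.
Proof. by rewrite step_ge0 step_le1. Qed.

Lemma cutoff01 m r x : 0 <= cutoff m r x <= 1.
Proof.
have /andP[h0 h1] := cutoff_base01 r x.
by rewrite exprn_ge0//= exprn_ile1.
Qed.

Lemma cutoff1 m r x : 0 < r -> enorm x <= r -> cutoff m r x = 1.
Proof.
move=> r0 xr; rewrite /cutoff /cutoff_base step1 ?expr1n//.
rewrite pmulr_lle0 ?invr_gt0// subr_le0 ler_pdivrMr ?exprn_gt0// mul1r.
by rewrite -sqr_enorm ler_pXn2r// nnegrE ?enorm_ge0// ltW.
Qed.

Lemma cutoff0 m r x : (0 < m)%N -> 0 < r -> 2 * r <= enorm x -> cutoff m r x = 0.
Proof.
move=> m0 r0 xr; rewrite /cutoff /cutoff_base step0 ?expr0n ?gtn_eqF//.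
rewrite ler_pdivlMr// mul1r lerBrDr ler_pdivlMr ?exprn_gt0//.
rewrite -sqr_enorm (_ : _ * _ = (2 * r) ^+ 2); last by ring.
by rewrite ler_pXn2r// nnegrE ?enorm_ge0// mulr_ge0// ltW.
Qed.

Lemma cutoff_gradient m : (0 < m)%N -> exists2 C : R, 0 <= C &
  forall r x, 0 < r -> enorm (gradient (cutoff m r) x) <=
    if x \in annulus r then C / r * cutoff m r x `^ (1 - m%:R^-1) else 0.
Proof.
move=> m0; have [ds [C [dsE dsC ds0]]] := @step_derive R.
have C0 : 0 <= C by apply: le_trans (dsC 0).
have dX (t : R) : is_derive t (1 : R) (fun t => step t ^+ m)
    (m%:R * step t ^+ m.-1 * ds t).
  by have := is_deriveX m (dsE t); rewrite exprfctE.
have m0R : 0 < m%:R :> R by rewrite ltr0n.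
exists (n%:R * (2 * m%:R * C)); first by rewrite !mulr_ge0.
move=> r x r0.
have r20 : 0 < r ^+ 2 by rewrite exprn_gt0.
have darg i : partial i (arg r) x = 2 * x ord0 i / r ^+ 2 / 3.
  have se : smooth (fun x : 'rV[R]_n => edot x x).
    by apply: smooth_sum => j; apply: smoothM; exact: smooth_coord.
  have sd : smooth (fun x : 'rV[R]_n => edot x x / r ^+ 2).
    by apply: smoothM => //; exact: smooth_cst.
  have sdB : smooth (fun x : 'rV[R]_n => edot x x / r ^+ 2 - 1).
    by apply: smoothD => //; exact: smooth_cst.
  have sc c : differentiable (fun _ : 'rV[R]_n => c : R) x.
    exact: smooth_differentiable (smooth_cst _).
  rewrite /arg partialM//; last exact: smooth_differentiable.
  rewrite partial_cst mulr0 add0r partialD//; last exact: smooth_differentiable.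
  rewrite partial_cst addr0 partialM//; last exact: smooth_differentiable.
  rewrite partial_cst mulr0 add0r /edot partial_sum; last first.
    by move=> j; apply: smooth_differentiable; apply: smoothM; exact: smooth_coord.
  rewrite (bigD1 i)//= big1 ?addr0 => [|j ji]; last first.
    rewrite partialM; [|exact: smooth_differentiable (smooth_coord _)..].
    by rewrite partial_coord eq_sym (negbTE ji) mulr0 addr0.
  rewrite partialM; [|exact: smooth_differentiable (smooth_coord _)..].
  by rewrite partial_coord eqxx mulr1 -mulr2n -mulr_natl; ring.
have dcut i : partial i (cutoff m r) x =
    m%:R * cutoff_base r x ^+ m.-1 * ds (arg r x) * (2 * x ord0 i / r ^+ 2 / 3).
  have [_ ->] := differentiable_fun_comp (dX (arg r x))
    (smooth_differentiable x (smooth_arg r)).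
  by rewrite darg.
case: ifPn => [xA|xA]; last first.
  (* Off the closed annulus the argument is strictly below 0 or strictly above 1, where the
     derivative of [step] is 0. *)
  have ds00 : ds (arg r x) = 0.
    apply: ds0; have [xr|xr] := ltP (enorm x) r.
      left; rewrite /arg pmulr_llt0 ?invr_gt0// subr_lt0 ltr_pdivrMr// mul1r.
      by rewrite -sqr_enorm ltr_pXn2r// nnegrE ?enorm_ge0// ltW.
    have xr2 : 2 * r < enorm x.
      rewrite ltNge; apply/negP => h; move: xA; rewrite notin_setE; apply.
      by split.
    right; rewrite /arg ltr_pdivlMr// mul1r ltrBrDr ltr_pdivlMr//.
    rewrite -sqr_enorm (_ : _ * _ = (2 * r) ^+ 2); last by ring.
    by rewrite ltr_pXn2r// nnegrE ?enorm_ge0// mulr_ge0// ltW.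
  rewrite -[leRHS](mulr0 n%:R); apply: enorm_le_coord => // i.
  by rewrite mxE dcut ds00 mulr0 mul0r normr0.
move: xA; rewrite inE => -[xr1 xr2].
have /andP[b0 b1] := cutoff_base01 r x.
have bm : cutoff m r x `^ (1 - m%:R^-1) = cutoff_base r x ^+ m.-1.
  rewrite -[RHS]powR_mulrn// /cutoff -powR_mulrn// -powRrM; congr (_ `^ _).
  rewrite mulrBr mulr1 divff ?gt_eqF//.
  by rewrite -subn1 natrB.
rewrite bm.
have -> : n%:R * (2 * m%:R * C) / r * cutoff_base r x ^+ m.-1 =
    n%:R * (2 * m%:R * C / r * cutoff_base r x ^+ m.-1) by ring.
have B0 : 0 <= cutoff_base r x ^+ m.-1 by rewrite exprn_ge0.
have rV0 : 0 <= r^-1 by rewrite invr_ge0 ltW.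
apply: enorm_le_coord => [|i]; first by rewrite !mulr_ge0.
rewrite mxE dcut.
have -> : m%:R * cutoff_base r x ^+ m.-1 * ds (arg r x) * (2 * x ord0 i / r ^+ 2 / 3) =
   (m%:R * cutoff_base r x ^+ m.-1) * (ds (arg r x) * (2 * x ord0 i / r ^+ 2 / 3)) by ring.
have -> : 2 * m%:R * C / r * cutoff_base r x ^+ m.-1 =
   (m%:R * cutoff_base r x ^+ m.-1) * (C * (2 / r)) by ring.
rewrite normrM ger0_norm; last by rewrite mulr_ge0// ltW.
apply: ler_wpM2l; first by rewrite mulr_ge0// ltW.
rewrite normrM; apply: ler_pM => //.
rewrite !normrM (ger0_norm (_ : 0 <= 2))// normfV (gtr0_norm r20).
rewrite normfV (ger0_norm (_ : 0 <= 3))//.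
have xi : `|x ord0 i| <= 2 * r by apply: le_trans xr2; exact: coord_le_enorm.
rewrite ler_pdivrMr// ler_pdivrMr//.
have -> : 2 / r * 3 * r ^+ 2 = 6 * r by field; rewrite gt_eqF.
lra.
Qed.

End cutoff.

(** * Test functions H(u) psi *)

Section truncated_power.
Context {R : realType}.
Variables (k s : R).
Hypothesis k0 : 0 < k.
Hypothesis s0 : 0 <= s.

Definition flat' (t : R) : R := flat_gen ((1 - 1^`()) * 'X^2) t.

(** The function H. Its factor [flat (t - k)] confines t^s to t > k > 0, where it is differentiable
    for every s. *)
Definition tpow (t : R) : R := flat (t - k) * t `^ s.

Definition tpow' (t : R) : R :=
  flat' (t - k) * t `^ s + flat (t - k) * (s * t `^ (s - 1)).

Lemma flat'_ge0 t : 0 <= flat' t.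
Proof.
rewrite /flat' /flat_gen -polyC1 derivC subr0 mul1r; case: ifP => // _.
by rewrite hornerXn mulr_ge0 ?expR_ge0// sqr_ge0.
Qed.

Lemma flat'_eq0 (t : R) : t <= 0 -> flat' t = 0.
Proof. by rewrite /flat' /flat_gen ltNge => ->. Qed.

Lemma flat_le1 (t : R) : flat t <= 1.
Proof.
rewrite flatE; case: ifP => // t0.
by rewrite -expR0 ler_expR oppr_le0 invr_ge0 ltW.
Qed.

Lemma continuous_flat_gen P : continuous (@flat_gen R P).
Proof.
move=> t; apply: differentiable_continuous; apply/derivable1_diffP.
by apply: ex_derive; exact: is_derive_flat_gen.
Qed.

Lemma tpow_eq0 t : t <= k -> tpow t = 0.
Proof. by move=> tk; rewrite /tpow flat_eq0 ?mul0r// subr_le0. Qed.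

Lemma tpow'_eq0 t : t <= k -> tpow' t = 0.
Proof.
by move=> tk; rewrite /tpow' flat_eq0 ?flat'_eq0 ?mul0r ?addr0// subr_le0.
Qed.

Lemma tpow_ge0 t : 0 <= tpow t.
Proof. by rewrite mulr_ge0 ?flat_ge0 ?powR_ge0. Qed.

Lemma tpow_gt0 t : k < t -> 0 < tpow t.
Proof.
by move=> kt; rewrite mulr_gt0 ?flat_gt0 ?subr_gt0// powR_gt0// (lt_trans k0).
Qed.

Lemma tpow_le t : tpow t <= t `^ s.
Proof. by rewrite ler_piMl ?powR_ge0 ?flat_le1. Qed.

Lemma tpow'_ge0 t : 0 <= tpow' t.
Proof.
by rewrite addr_ge0// mulr_ge0 ?flat'_ge0 ?flat_ge0 ?powR_ge0// mulr_ge0// powR_ge0.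
Qed.

(** Equality holds for the pure power t^s; the derivative of the factor [flat (t - k)] only adds a
    nonnegative term. *)
Lemma tpow_le_tpow' t : s * tpow t <= tpow' t * t.
Proof.
have [tk|kt] := leP t k; first by rewrite tpow_eq0// tpow'_eq0// mulr0 mul0r.
have t0 : 0 < t by exact: lt_trans kt.
rewrite /tpow' mulrDl; apply: (@le_trans _ _ (flat (t - k) * (s * t `^ (s - 1)) * t)).
  have -> : flat (t - k) * (s * t `^ (s - 1)) * t =
      s * (flat (t - k) * (t `^ (s - 1) * t)) by ring.
  have -> : t `^ (s - 1) * t = t `^ s.
    rewrite -[X in _ * X](powRr1 (ltW t0)) -powRD; last by rewrite (gt_eqF t0) implybT.
    by rewrite subrK.
  exact: lexx.
by rewrite lerDr !mulr_ge0 ?flat'_ge0 ?powR_ge0// ltW.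
Qed.

Lemma near_tpow (t : R) : t <= 0 -> \forall z \near t, z <= k.
Proof.
move=> t0; near=> z; apply: ltW; near: z; apply: lt_nbhsl.
exact: le_lt_trans k0.
Unshelve. all: by end_near. Qed.

Lemma is_derive_tpow t : is_derive t (1 : R) tpow (tpow' t).
Proof.
have [t0|t0] := ltP 0 t; last first.
  rewrite tpow'_eq0; last exact: le_trans (ltW k0).
  apply: near_eq_is_derive (is_derive_cst (0 : R) t 1).
  by apply: filterS (near_tpow t0) => z zk; rewrite /cst tpow_eq0.
have d1 : is_derive t (1 : R) (fun z : R => flat (z - k)) (flat' (t - k)).
  have := is_derive1_comp (f := flat) (g := shift (- k))
    (is_derive_flat_gen 1 (t - k)) (is_derive_shift t (1 : R) (- k)).
  by rewrite mulr1.
have d2 := is_derive1_powR s t0.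
apply: (is_derive_eq (is_deriveM d1 d2)).
by rewrite /tpow' addrC; congr (_ + _); rewrite -[LHS]/(_ * _) mulrC.
Qed.

Lemma continuous_tpow' : continuous tpow'.
Proof.
move=> t; have [t0|t0] := ltP 0 t; last first.
  rewrite /continuous_at tpow'_eq0; last exact: le_trans (ltW k0).
  apply/cvgrPdist_le => e e0; apply: filterS (near_tpow t0) => z zk.
  by rewrite tpow'_eq0// subrr normr0 ltW.
have cp c : {for t, continuous (fun z : R => z `^ c)}.
  apply: differentiable_continuous; apply/derivable1_diffP.
  by apply: ex_derive; exact: is_derive1_powR.
have cf P : {for t, continuous (fun z : R => flat_gen P (z - k))}.
  apply: continuous_comp; last exact: continuous_flat_gen.
  by apply: cvgB; [exact: cvg_id|exact: cvg_cst].
apply: cvgD; first by apply: cvgM; [exact: cf|exact: cp].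
apply: cvgM; first exact: cf.
by apply: cvgM; [exact: cvg_cst|exact: cp].
Qed.

Lemma of_class_C1_tpow n (u : 'rV[R]_n -> R) : of_class_C 1 u ->
  of_class_C 1 (fun x => tpow (u x)) /\
  forall i x, partial i (fun x => tpow (u x)) x = tpow' (u x) * partial i u x.
Proof.
move=> [du pu].
have dp i x : partial i (fun x => tpow (u x)) x = tpow' (u x) * partial i u x.
  by case: (differentiable_fun_comp (is_derive_tpow (u x)) (du x)).
split=> //; split=> [x|i].
  by case: (differentiable_fun_comp (is_derive_tpow (u x)) (du x)).
rewrite (_ : partial i _ = fun x => tpow' (u x) * partial i u x); last first.
  by apply/funext => x.
apply: of_class_CM; last exact: pu.
move=> x.
exact: (cvg_comp _ _ (differentiable_continuous (du x)) (@continuous_tpow' (u x))).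
Qed.

End truncated_power.

Section core.
Context {R : realType} {n : nat}.
Local Notation mu := (@lebesgue_rV R n).
Implicit Types (x : 'rV[R]_n) (u : 'rV[R]_n -> R).

Lemma edot_p_flux_gradient p u x : 1 < p ->
  edot (p_flux p u x) (gradient u x) = enorm (gradient u x) `^ p.
Proof.
move=> p1; rewrite edotZl -sqr_enorm.
have [->|G0] := eqVneq (enorm (gradient u x)) 0.
  by rewrite expr0n mulr0 powR0// gt_eqF// (lt_trans ltr01).
rewrite -powR_mulrn ?enorm_ge0// -powRD ?G0 ?implybT//.
by rewrite subrK.
Qed.

Lemma enorm_p_flux_le p u x v : 1 < p ->
  `|edot (p_flux p u x) v| <= enorm (gradient u x) `^ (p - 1) * enorm v.
Proof.
move=> p1; rewrite edotZl normrM (ger0_norm (powR_ge0 _ _)).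
apply: (le_trans (ler_wpM2l (powR_ge0 _ _) (edot_le _ _))).
rewrite mulrA; apply: ler_wpM2r; first exact: enorm_ge0.
have [->|G0] := eqVneq (enorm (gradient u x)) 0; first by rewrite mulr0 powR_ge0.
rewrite -{2}[enorm _]powRr1 ?enorm_ge0// -powRD; last by rewrite G0 implybT.
by rewrite (_ : p - 2 + 1 = p - 1)//; ring.
Qed.

(** At a zero of u only right continuity of f is available; it suffices because u is nonnegative
    nearby. *)
Lemma continuous_comp_ge0 (f : R -> R) u : {within `[0, +oo[, continuous f} ->
  continuous u -> (forall x, 0 <= u x) -> continuous (fun x => f (u x)).
Proof.
move=> cf cu u0 x.
have /continuous_within_itvcyP[cf1 cf0] := cf.
have [ux0|ux0] := ltP 0 (u x).
  have cfx : {for u x, continuous f} by apply: cf1; rewrite in_itv/= ux0.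
  exact: (cvg_comp _ _ (cu x) cfx).
apply: (cvgrPdist_le (FF := nbhs_filter x) _ _).2 => e e0.
have ux : u x = 0 by apply/eqP; rewrite eq_le ux0 u0.
move/cvgrPdist_le : cf0 => /(_ e e0) h.
have [d /= d0 hd] := h.
move/cvgrPdist_lt : (cu x) => /(_ d d0); apply: filterS => y /=.
rewrite ux sub0r normrN => uyd.
have [->|uy0] := eqVneq (u y) 0; first by rewrite subrr normr0 ltW.
apply: hd; last by rewrite lt_def uy0 u0.
by rewrite /ball_/= sub0r normrN.
Qed.

(** All cases are reduced to one pointwise inequality, in which the flux against the gradient of the
    cutoff has already been replaced by its bound. Each case then only supplies s, Y, X and this
    inequality. *)
Lemma nonexistence_core (p alpha : R) (a b : 'rV[R]_n -> R) (f : R -> R) u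
    (k s R1 R2 K t M0 C : R) (m : nat) (Y : 'rV[R]_n -> R) (X : R -> 'rV[R]_n -> R) :
  (0 < n)%N -> 1 < p -> 0 <= alpha -> Linfty_loc a -> Linfty_loc b ->
  {within `[0, +oo[, continuous f} -> large_solution p alpha a b f u ->
  0 < k -> 0 <= s -> (0 < m)%N -> 0 < R1 -> 0 < t < 1 -> 0 <= K ->
  (forall r x, 0 < r -> enorm (gradient (cutoff m r) x) <=
    if x \in annulus r then C / r * cutoff m r x `^ (1 - m%:R^-1) else 0) ->
  Linfty_loc Y -> {ae mu, forall x, 0 <= Y x} ->
  {ae mu, forall x, R2 <= enorm x -> 0 < Y x} ->
  (forall r x, 0 <= X r x) -> (forall r, lebesgue_measurable_fun (X r)) ->
  (forall r, R1 <= r -> (\int[mu]_(x in annulus r) (X r x)%:E <= M0%:E)%E) ->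
  (forall r, R1 <= r -> {ae mu, forall x,
    let G := enorm (gradient u x) in let psi := cutoff m r x in
    let H := tpow k s (u x) in
    Y x * psi + (if x \in annulus r then
        H * G `^ (p - 1) * (C / r * psi `^ (1 - m%:R^-1)) else 0) <=
    tpow' k s (u x) * G `^ p * psi +
    (a x * f (u x) + b x * G `^ alpha) * (H * psi) +
    (if x \in annulus r then K * ((Y x * psi) `^ (1 - t) * X r x `^ t) else 0)}) ->
  False.
Proof.
move=> n0 p1 al0 aL bL cf [uC u_ge0 up ul] k0 s0 m0 R10 t01 K0 dcut YL Y0 Ypos X0 mX XM key.
have cu : continuous u by move=> x; apply: differentiable_continuous; case: uC.
pose g x := a x * f (u x) + b x * enorm (gradient u x) `^ alpha.
have gL : Linfty_loc g.
  have h1 := Linfty_loc_continuous (continuous_comp_ge0 cf cu u_ge0).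
  have h2 := Linfty_loc_continuous (continuous_enorm_gradient uC).
  have h3 := Linfty_loc_powR (fun x => enorm_ge0 (gradient u x)) al0 h2.
  exact: (Linfty_locD (Linfty_locM aL h1) (Linfty_locM bL h3)).
have [HC dH] := of_class_C1_tpow s k0 uC.
pose v r x := tpow k s (u x) * cutoff m r x.
have vC r : of_class_C 1 (v r) by exact: (of_class_CM HC (smooth_cutoff m r 1%N)).
have v_ge0 r x : 0 <= v r x.
  by rewrite mulr_ge0 ?tpow_ge0//; case/andP : (cutoff01 m r x).
have v0 r x : 0 < r -> ~ cube (2 * r) x -> v r x = 0.
  move=> r0 xr; rewrite /v cutoff0 ?mulr0// leNgt; apply/negP => h.
  by apply: xr; apply: enorm_coord_cube; exact: ltW.
pose Z r x := edot (p_flux p u x) (gradient (v r) x) + g x * v r x.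
have ZE r x : edot (p_flux p u x) (gradient (v r) x) =
   tpow' k s (u x) * enorm (gradient u x) `^ p * cutoff m r x +
   tpow k s (u x) * edot (p_flux p u x) (gradient (cutoff m r) x).
  rewrite -edot_p_flux_gradient// !edot_gradientE mulr_sumr mulr_suml mulr_sumr.
  rewrite -big_split/=; apply: eq_bigr => i _.
  rewrite /v partialM; [|by case: HC|exact: smooth_differentiable (smooth_cutoff _ _)].
  by rewrite dH; ring.
apply: (@vanishing_contradiction R n (cutoff m) _ _ _ _ Y X Z K t M0 R1 R10 t01 K0
  YL Y0 X0 mX XM _ _ _ R2 n0 Ypos).
- by move=> r; exact: (smooth_cutoff m r 0%N).
- exact: cutoff01.
- by move=> r x; exact: cutoff1.
- by move=> r x; exact: cutoff0.
- move=> r rR; have r0 : 0 < r by exact: lt_le_trans rR.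
  have [h1 h2] := Linfty_loc_weak_form p1 uC gL (vC r).
  have v0r x := @v0 r x r0.
  apply: (@Linfty_loc_integrable _ _ _ (2 * r)); first exact: Linfty_locD.
  move=> x xr; rewrite /Z; have [-> ->] := weak_form_off_cube p u g v0r xr.
  by rewrite addr0.
- move=> r rR; have r0 : 0 < r by exact: lt_le_trans rR.
  apply: (@p_laplacian_ge_C1 _ _ _ _ _ _ (2 * r)) => //.
    by rewrite mulr_ge0// ltW.
  by move=> x; exact: v0.
- move=> r rR; have r0 : 0 < r by exact: lt_le_trans rR.
  apply: filterS (key r rR) => x /=; rewrite /Z ZE -/(g x) -/(v r x) => h.
  (* The cross term of the weak form is bounded below through Cauchy-Schwarz and the gradient bound
     of the cutoff; off the annulus it vanishes. *)
  suff : - (if x \in annulus r then tpow k s (u x) * enorm (gradient u x) `^ (p - 1) *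
      (C / r * cutoff m r x `^ (1 - m%:R^-1)) else 0) <=
      tpow k s (u x) * edot (p_flux p u x) (gradient (cutoff m r) x).
    move: h; set I1 := (if _ then _ else 0); set I2 := (if _ then _ else 0).
    set E1 := edot _ _; set T1 := tpow' _ _ _ * _ * _; set Yp := Y x * _.
    by move: (tpow k s (u x) * E1) (g x * v r x) => c1 c2; lra.
  rewrite lerNl -mulrN; have Hge0 := tpow_ge0 k s (u x).
  have := dcut r x r0; case: ifPn => xA hA.
    rewrite -mulrA ler_wpM2l//; apply: (le_trans (ler_norm _)); rewrite normrN.
    apply: (le_trans (enorm_p_flux_le _ _ _ p1)).
    by rewrite ler_wpM2l ?powR_ge0.
  rewrite -(mulr0 (tpow k s (u x))) ler_wpM2l//.
  apply: (le_trans (ler_norm _)); rewrite normrN.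
  apply: (le_trans (enorm_p_flux_le _ _ _ p1)).
  by rewrite mulr_ge0_le0 ?powR_ge0.
Qed.

End core.

(** * Pointwise inequalities *)

Section limsup.
Context {R : realType}.

Lemma limf_esup_pinfty_lt (F : R -> \bar R) (l : \bar R) :
  (limf_esup F (pinfty_nbhs R) < l)%E ->
  exists2 s, (s < l)%E & exists r1 : R, forall r, r1 < r -> (F r <= s)%E.
Proof.
rewrite /limf_esup => /ereal_inf_lt[_ [V [r1 [_ Vr1]] <-] sl].
exists (ereal_sup (F @` V)) => //; exists r1 => r r1r.
by apply: ereal_sup_ubound; exists r => //; exact: Vr1.
Qed.

Lemma limf_esup_pinfty_lty (F : R -> \bar R) :
  (limf_esup F (pinfty_nbhs R) < +oo)%E ->
  exists M r1 : R, forall r, r1 < r -> (F r <= M%:E)%E.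
Proof.
move=> /limf_esup_pinfty_lt[[s| |]// _ [r1 H]]; first by exists s, r1.
by exists 0, r1 => r /H /le_trans; apply; rewrite leNye.
Qed.

Lemma limf_einf_pinfty_gt0 (F : R -> R) :
  (0 < limf_einf (fun t => (F t)%:E) (pinfty_nbhs R))%E ->
  exists c k : R, [/\ 0 < c, 0 < k & forall t, k <= t -> c <= F t].
Proof.
rewrite /limf_einf oppe_gt0 => /limf_esup_pinfty_lt[s s0 [r1 H]].
have [c c0 cs] : exists2 c : R, 0 < c & (s <= (- c)%:E)%E.
  case: s s0 {H} => [s|//|_]; last by exists 1 => //; rewrite leNye.
  by rewrite lte_fin => s0; exists (- s); rewrite ?oppr_gt0// opprK.
exists c, (`|r1| + 1); split=> // t rt; have /H : r1 < t.
  by apply: lt_le_trans rt; apply: (le_lt_trans (ler_norm _)); rewrite ltrDl.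
by move=> /le_trans /(_ cs); rewrite -EFinN lee_fin lerN2.
Qed.

End limsup.

Section pointwise.
Context {R : realType}.

Lemma expR_powR (l y : R) : expR l `^ y = expR (y * l).
Proof. by rewrite /powR gt_eqF ?expR_gt0// expRK. Qed.

(** Writing every positive quantity as an exponential turns inequalities between products of powers
    into linear ones between logarithms. *)
Lemma gt0_expR (x : R) : 0 < x -> exists l, x = expR l.
Proof. by move=> x0; exists (ln x); rewrite lnK. Qed.

Lemma exists_inv_le (t : R) : 0 < t -> exists2 m : nat, (1 < m)%N & m%:R^-1 <= t.
Proof.
move=> t0; exists (Num.bound t^-1).+2 => //.
rewrite -[leRHS]invrK lef_pV2 ?posrE ?invr_gt0//.
apply: (le_trans (ltW (archi_boundP _))); first by rewrite invr_ge0 ltW.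
by rewrite ler_nat; do 2!apply: leqW.
Qed.

Variables (p theta c C : R) (m : nat).
Hypothesis p1 : 1 < p.
Hypothesis c0 : 0 < c.
Hypothesis C0 : 0 <= C.
Hypothesis m1 : (1 < m)%N.

Let m_exp_neq0 : 1 - m%:R^-1 != 0 :> R.
Proof.
rewrite subr_eq0 eq_sym invr_eq1; apply/eqP => m1'.
by move: m1; rewrite -(ltr_nat R) m1' ltxx.
Qed.

(* Weighted geometric means: the exponents [(p-1)/alpha], [(theta-p+1)/alpha]
   and [t = (alpha-theta)/alpha] add up to [1], and with [s] as below all powers
   of [a], [b], [|Du|] and [u] match. *)
Lemma pointwise_gradient_term (alpha q : R) :
  p - 1 <= theta -> theta < alpha ->
  let t := (alpha - theta) / alpha in
  let s := q * (theta - p + 1) / (alpha - theta) in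
  m%:R^-1 <= t ->
  forall a b G U H psi r, 0 < a -> 0 < b -> 0 <= G -> 0 < U -> 0 <= H <= U `^ s ->
    0 <= psi <= 1 -> 0 < r ->
  H * G `^ (p - 1) * (C / r * psi `^ (1 - m%:R^-1)) <=
  C * c `^ (- ((theta - p + 1) / alpha)) *
    (((c * a * U `^ q + b * G `^ alpha) * H * psi) `^ (1 - t) *
     (r `^ (alpha / (theta - alpha)) *
        (a `^ (theta / (p - 1) - 1) * b) `^ ((p - 1) / (theta - alpha))) `^ t).
Proof.
have p1' := p1.
move=> pth tha t s mt a b G U H psi r a0 b0 G0 U0 /andP[H0 HU] /andP[psi0 psi1] r0.
have al0 : 0 < alpha by lra.
have rhs0 x y : 0 <= C * c `^ (- ((theta - p + 1) / alpha)) * (x `^ (1 - t) * y `^ t).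
  by rewrite !mulr_ge0 ?powR_ge0.
(* Where G, H or psi vanishes, so does the left-hand side; elsewhere logarithms are available. *)
have [->|Gn0] := eqVneq G 0.
  by rewrite powR0 ?mulr0 ?mul0r// gt_eqF// subr_gt0.
have [->|Hn0] := eqVneq H 0; first by rewrite !mul0r.
have [->|psin0] := eqVneq psi 0.
  by rewrite [0 `^ (1 - m%:R^-1)]powR0// !mulr0.
have [lg Gl] : exists l, G = expR l by apply: gt0_expR; rewrite lt_def Gn0.
have [lh Hl] : exists l, H = expR l by apply: gt0_expR; rewrite lt_def Hn0.
have [lp pl] : exists l, psi = expR l by apply: gt0_expR; rewrite lt_def psin0.
have [la al] := gt0_expR a0; have [lb bl] := gt0_expR b0.
have [lu Ul] := gt0_expR U0; have [lr rl] := gt0_expR r0.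
have [lc cl] := gt0_expR c0.
have lp0 : lp <= 0 by rewrite -ler_expR expR0 -pl.
have lhu : lh <= s * lu by rewrite -ler_expR -expR_powR -Hl -Ul.
pose A := (p - 1) / alpha; pose B := (theta - p + 1) / alpha.
have A0 : 0 <= A by rewrite divr_ge0//; lra.
have B0 : 0 <= B by rewrite divr_ge0//; lra.
have tE : 1 - t = A + B by rewrite /t /A /B; field; exact: lt0r_neq0.
have t0 : 0 <= t by rewrite divr_ge0//; lra.
(* The power 1 - t = A + B of the sum is split, keeping only the gradient term in the power A and
   only the source term in the power B. *)
have sumE : expR (A * (lb + alpha * lg) + B * (lc + la + q * lu)) <=
    (c * a * U `^ q + b * G `^ alpha) `^ (1 - t).
  rewrite tE expRD powRD; last first.
    apply/implyP => _; rewrite gt_eqF// ltr_wpDr ?mulr_ge0 ?powR_ge0// ?(ltW b0)//.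
    by rewrite !mulr_gt0// powR_gt0.
  have e1 : expR (lb + alpha * lg) = b * G `^ alpha by rewrite expRD bl Gl expR_powR.
  have e2 : expR (lc + la + q * lu) = c * a * U `^ q.
    by rewrite !expRD cl al Ul expR_powR.
  have h1 : 0 <= b * G `^ alpha by rewrite -e1 expR_ge0.
  have h2 : 0 <= c * a * U `^ q by rewrite -e2 expR_ge0.
  rewrite -!expR_powR e1 e2.
  apply: ler_pM; rewrite ?powR_ge0//.
    by apply: ge0_ler_powR; rewrite ?nnegrE ?addr_ge0// lerDr.
  by apply: ge0_ler_powR; rewrite ?nnegrE ?addr_ge0// lerDl.
have S0 : 0 <= c * a * U `^ q + b * G `^ alpha.
  by rewrite addr_ge0 ?mulr_ge0 ?powR_ge0// ltW.
rewrite -[X in (X `^ (1 - t))]mulrA powRM ?mulr_ge0//.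
apply: (@le_trans _ _ (C * c `^ (- B) *
    (expR (A * (lb + alpha * lg) + B * (lc + la + q * lu)) * (H * psi) `^ (1 - t) *
     (r `^ (alpha / (theta - alpha)) *
        (a `^ (theta / (p - 1) - 1) * b) `^ ((p - 1) / (theta - alpha))) `^ t))).
  have lhsE : H * G `^ (p - 1) * (C / r * psi `^ (1 - m%:R^-1)) =
      C * expR (lh + (p - 1) * lg - lr + (1 - m%:R^-1) * lp).
    by rewrite Hl Gl rl pl !expR_powR !expRD expRN; ring.
  rewrite lhsE cl Hl pl rl al bl !(expR_powR, =^~ expRD) -mulrA -!expRD.
  rewrite ler_wpM2l// ler_expR -subr_ge0.
  set E := (X in 0 <= X).
  (* What remains of the exponents is a nonnegative combination of the slacks in H <= U^s and psi <=
     1. *)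
  have -> : E = t * (s * lu - lh) + (t - m%:R^-1) * - lp.
    have n1 : alpha != 0 by rewrite gt_eqF.
    have n2 : p - 1 != 0 by rewrite gt_eqF// subr_gt0.
    have n3 : theta - alpha != 0 by rewrite lt_eqF// subr_lt0.
    have n4 : alpha - theta != 0 by rewrite gt_eqF// subr_gt0.
    have n5 : m%:R != 0 :> R by rewrite pnatr_eq0 gtn_eqF// ltnW.
    rewrite /E /A /B /t /s; field.
    by rewrite ?n1 ?n2 ?n3 ?n4 ?n5.
  by rewrite addr_ge0// mulr_ge0// ?subr_ge0// oppr_ge0.
apply: ler_wpM2l; first by rewrite mulr_ge0 ?powR_ge0.
apply: ler_wpM2r; first exact: powR_ge0.
by apply: ler_wpM2r => //; exact: powR_ge0.
Qed.

(* As [H <= H' u / s], the left-hand side is a weighted geometric mean of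
   [H' |Du|^p psi] and of a multiple of
   [(Y psi)^(1-t) (r^(p q/(theta-q)) a^(theta/(theta-q)))^t]. *)
Lemma pointwise_source_term (q : R) : p - 1 < theta -> theta < q ->
  let t := 1 - theta / q in
  let s := q * (theta - p + 1) / (q - theta) in
  m%:R^-1 <= t / p ->
  exists2 K, 0 <= K & forall a G U H H' psi r, 0 < a -> 0 <= G -> 0 < U ->
    0 <= H <= U `^ s -> s * H <= H' * U -> 0 <= psi <= 1 -> 0 < r ->
  H * G `^ (p - 1) * (C / r * psi `^ (1 - m%:R^-1)) <=
  H' * G `^ p * psi +
    K * ((c * a * U `^ q * H * psi) `^ (1 - t) *
     (r `^ (p * q / (theta - q)) * a `^ (theta / (theta - q))) `^ t).
Proof.
have p1' := p1.
move=> pth thq t s mt.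
have q0 : 0 < q by lra.
have s0 : 0 < s by rewrite divr_gt0 ?mulr_gt0//; lra.
have t0 : 0 < t by rewrite subr_gt0 ltr_pdivrMr// mul1r.
have pV : 0 < p^-1 < 1.
  by apply/andP; split; [rewrite invr_gt0; lra|rewrite invf_lt1//; lra].
have [ls sl] := gt0_expR s0; have [lc cl] := gt0_expR c0.
(* Besides C, it contains s^(-(1-1/p)), lost in H <= H' U / s, and c^(-theta/(p q)), which offsets
   the factor c in Y. *)
pose kap := C * expR (- ((1 - p^-1) * ls + theta / (p * q) * lc)).
have kap0 : 0 <= kap by rewrite mulr_ge0// expR_ge0.
have [K K0 HK] := young_powR pV kap0 ltr01.
exists K => // a G U H H' psi r a0 G0 U0 /andP[H0 HU] HH' /andP[psi0 psi1] r0.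
have H'0 : 0 <= H'.
  by rewrite -(pmulr_lge0 _ U0); apply: le_trans HH'; rewrite mulr_ge0// ltW.
have rhs0 : 0 <= H' * G `^ p * psi +
    K * ((c * a * U `^ q * H * psi) `^ (1 - t) *
     (r `^ (p * q / (theta - q)) * a `^ (theta / (theta - q))) `^ t).
  by rewrite addr_ge0// !mulr_ge0 ?powR_ge0.
have [Gz|Gn0] := eqVneq G 0.
  by rewrite {1}Gz [0 `^ (p - 1)]powR0 ?mulr0 ?mul0r// gt_eqF// subr_gt0.
have [Hz|Hn0] := eqVneq H 0; first by rewrite {1}Hz !mul0r.
have [psiz|psin0] := eqVneq psi 0.
  by rewrite {1}psiz [0 `^ (1 - m%:R^-1)]powR0// !mulr0.
have H'n0 : 0 < H'.
  rewrite -(pmulr_lgt0 _ U0); apply: lt_le_trans HH'.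
  by rewrite mulr_gt0// lt_def Hn0.
have [lg Gl] : exists l, G = expR l by apply: gt0_expR; rewrite lt_def Gn0.
have [lh Hl] : exists l, H = expR l by apply: gt0_expR; rewrite lt_def Hn0.
have [lp pl] : exists l, psi = expR l by apply: gt0_expR; rewrite lt_def psin0.
have [la al] := gt0_expR a0; have [lh' Hl'] := gt0_expR H'n0.
have [lu Ul] := gt0_expR U0; have [lr rl] := gt0_expR r0.
have lp0 : lp <= 0 by rewrite -ler_expR expR0 -pl.
have lhu : lh <= s * lu by rewrite -ler_expR -expR_powR -Hl -Ul.
have lhh : ls + lh - lu <= lh'.
  by rewrite lerBlDr -ler_expR !expRD -sl -Hl -Hl' -Ul.
set x := H' * G `^ p * psi; set y := _ * _ `^ t.
have x0 : 0 <= x by rewrite /x !mulr_ge0 ?powR_ge0.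
have y0 : 0 <= y by rewrite /y mulr_ge0 ?powR_ge0.
have := HK x y x0 y0; rewrite mul1r; apply: le_trans.
have lhsE : H * G `^ (p - 1) * (C / r * psi `^ (1 - m%:R^-1)) =
    C * expR (lh + (p - 1) * lg - lr + (1 - m%:R^-1) * lp).
  by rewrite Hl Gl rl pl !expR_powR !expRD expRN; ring.
rewrite lhsE /x /y /kap cl Hl' Gl Hl pl rl al Ul !(expR_powR, =^~ expRD) -mulrA -!expRD.
rewrite ler_wpM2l// ler_expR -subr_ge0.
set E := (X in 0 <= X).
(* The three slacks are those of s H <= H' U, H <= U^s and psi <= 1; the last one needs 1/m <=
   t/p. *)
have -> : E = (1 - p^-1) * (lh' - (ls + lh - lu)) + t / p * (s * lu - lh) +
    (t / p - m%:R^-1) * - lp.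
  have n1 : q != 0 by rewrite gt_eqF.
  have n2 : p != 0 by rewrite gt_eqF// (lt_trans ltr01).
  have n3 : theta - q != 0 by rewrite lt_eqF// subr_lt0.
  have n4 : q - theta != 0 by rewrite gt_eqF// subr_gt0.
  have n5 : m%:R != 0 :> R by rewrite pnatr_eq0 gtn_eqF// ltnW.
  rewrite /E /t /s; field.
  by rewrite ?n1 ?n2 ?n3 ?n4 ?n5.
have /andP[pV0 pV1] := pV.
rewrite !addr_ge0// mulr_ge0// ?subr_ge0// ?oppr_ge0//; first exact: ltW.
by rewrite mulr_ge0// ltW.
Qed.

End pointwise.

(** * The two cases *)

Section cases.
Context {R : realType} {n : nat}.
Local Notation mu := (@lebesgue_rV R n).
Variables (p alpha : R) (a b : 'rV[R]_n -> R) (f : R -> R) (R0 : R)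
  (u : 'rV[R]_n -> R) (q c k : R).
Hypothesis n0 : (0 < n)%N.
Hypothesis p1 : 1 < p.
Hypothesis al0 : 0 <= alpha.
Hypothesis aL : Linfty_loc a.
Hypothesis bL : Linfty_loc b.
Hypothesis a0 : {ae mu, forall x : 'rV[R]_n, 0 <= a x}.
Hypothesis b0 : {ae mu, forall x : 'rV[R]_n, 0 <= b x}.
Hypothesis cf : {within `[0, +oo[, continuous f}.
Hypothesis ab0 : {ae mu, forall x : 'rV[R]_n, R0 <= enorm x -> 0 < a x /\ 0 < b x}.
Hypothesis usol : large_solution p alpha a b f u.
Hypothesis q0 : 0 < q.
Hypothesis c0 : 0 < c.
Hypothesis k0 : 0 < k.
Hypothesis fq : forall t, k <= t -> c * t `^ q <= f t.

Let u_ge0 x : 0 <= u x.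
Proof. by case: usol. Qed.

Let uC : of_class_C 1 u.
Proof. by case: usol. Qed.

Let Linfty_loc_u : Linfty_loc (fun x => u x `^ q).
Proof.
apply: (Linfty_loc_powR u_ge0 (ltW q0)); apply: Linfty_loc_continuous.
exact: (of_class_CS uC).
Qed.

Let Linfty_loc_tpow s : Linfty_loc (fun x => tpow k s (u x)).
Proof.
apply: Linfty_loc_continuous; have [+ _] := of_class_C1_tpow s k0 uC.
exact: of_class_CS.
Qed.

Let large_u : exists2 R2, R0 <= R2 & forall x, R2 <= enorm x -> k < u x.
Proof.
have [_ _ _ ul] := usol; have [r ur] := ul (k + 1).
exists (Num.max R0 r); first by rewrite le_max lexx.
move=> x; rewrite ge_max => /andP[_ /ur]; apply: lt_le_trans.
by rewrite ltrDl.
Qed.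

(** Besides giving a uniform bound, R1 is taken at least R0, so that the annuli lie where a and b
    are positive almost everywhere. *)
Let scaled_limsup e (w : 'rV[R]_n -> R) :
  lebesgue_measurable_fun w -> (forall x, 0 <= w x) ->
  (limf_esup (fun r : R => (r `^ e)%:E * \int[mu]_(x in annulus r) (w x)%:E)
    (pinfty_nbhs R) < +oo)%E ->
  exists M R1 : R, [/\ 0 < R1, R0 <= R1 & forall r, R1 <= r ->
    (\int[mu]_(x in annulus r) (r `^ e * w x)%:E <= M%:E)%E].
Proof.
move=> mw w0 /limf_esup_pinfty_lty[M [r1 H]].
exists M, (Num.max (`|r1| + 1) R0); split.
- by rewrite lt_max ltr_wpDl.
- by rewrite le_max lexx orbT.
move=> r; rewrite ge_max => /andP[rr _].
have /H : r1 < r.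
  by apply: lt_le_trans rr; apply: (le_lt_trans (ler_norm _)); rewrite ltrDl.
apply: le_trans; under eq_integral do rewrite EFinM.
rewrite ge0_integralZl_EFin; first exact: lexx.
- exact: measurable_annulus.
- by move=> x _; rewrite lee_fin.
- by apply/measurable_EFinP; exact: measurable_funTS.
- exact: powR_ge0.
Qed.

(** Where u <= k both sides vanish with [tpow]; elsewhere f(u) >= c u^q. *)
Let source_ge x s psi : 0 <= a x -> 0 <= psi ->
  c * a x * u x `^ q * tpow k s (u x) * psi <= a x * f (u x) * (tpow k s (u x) * psi).
Proof.
move=> ax psi0; have [uk|ku] := leP (u x) k.
  by rewrite tpow_eq0// mulr0 !mul0r mulr0.
rewrite mulrA; apply: ler_wpM2r => //; apply: ler_wpM2r; first exact: tpow_ge0.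
by rewrite [c * _]mulrC -mulrA ler_wpM2l// fq// ltW.
Qed.

Lemma no_solution_source theta : p - 1 < theta -> theta < q ->
  (limf_esup (fun r : R => (r `^ (p * q / (theta - q)))%:E *
     \int[mu]_(x in annulus r) (a x `^ (theta / (theta - q)))%:E)
     (pinfty_nbhs R) < +oo)%E -> False.
Proof.
move=> pth thq lim.
have p1' := p1; have q0' := q0.
pose t := 1 - theta / q; pose s := q * (theta - p + 1) / (q - theta).
have th0 : 0 < theta by lra.
have t01 : 0 < t < 1.
  apply/andP; split; first by rewrite subr_gt0 ltr_pdivrMr// mul1r.
  by rewrite gtrBl divr_gt0.
have s0 : 0 <= s by rewrite divr_ge0 ?mulr_ge0//; lra.
have tp0 : 0 < t / p by rewrite divr_gt0//; [case/andP : t01|lra].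
have [m m1 mt] := exists_inv_le tp0.
have m0 : (0 < m)%N by exact: ltnW.
have [C C0 HC] := @cutoff_gradient R n m m0.
have [K K0 HK] := pointwise_source_term p1 c0 C0 m1 pth thq mt.
have mw : lebesgue_measurable_fun (fun x => a x `^ (theta / (theta - q))).
  by apply: (measurableT_comp (@measurable_powR R _)); case: aL.
have [M [R1 [R10 R01 XM]]] := scaled_limsup mw (fun x => powR_ge0 _ _) lim.
have [R2 R02 uR2] := large_u.
pose Y x := c * a x * u x `^ q * tpow k s (u x).
apply: (@nonexistence_core R n p alpha a b f u k s R1 R2 K t M C m Y
  (fun r x => r `^ (p * q / (theta - q)) * a x `^ (theta / (theta - q)))
  n0 p1 al0 aL bL cf usol k0 s0 m0 R10 t01 K0 HC _ _ _ _ _ XM).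
- have h := Linfty_locM (Linfty_locM (Linfty_loc_cst c) aL) Linfty_loc_u.
  exact: (Linfty_locM h (Linfty_loc_tpow s)).
- apply: filterS a0 => x ax; apply: mulr_ge0; last exact: tpow_ge0.
  by rewrite mulr_ge0 ?powR_ge0// mulr_ge0// ltW.
- apply: (filterS _ ab0) => x h xR; have [ax _] := h (le_trans R02 xR).
  have ux := uR2 x xR.
  apply: mulr_gt0; last exact: tpow_gt0.
  by rewrite !mulr_gt0// powR_gt0// (lt_trans k0).
- by move=> r x; rewrite mulr_ge0 ?powR_ge0.
- move=> r; apply: measurable_funM; last exact: mw.
  exact: measurable_cst.
move=> r rR; have r0 : 0 < r by exact: lt_le_trans rR.
apply: filterS3 a0 b0 ab0 => x ax bx abx /=.
have /andP[psi0 psi1] := cutoff01 m r x.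
set psi := cutoff m r x in psi0 psi1 *; set G := enorm _.
have G0 : 0 <= G by exact: enorm_ge0.
have H0 := tpow_ge0 k s (u x).
have src : Y x * psi <= a x * f (u x) * (tpow k s (u x) * psi).
  exact: source_ge.
(* The gradient term of the equation is discarded in this case; only its sign matters. *)
have grd : 0 <= b x * G `^ alpha * (tpow k s (u x) * psi).
  by rewrite !mulr_ge0 ?powR_ge0 ?flat_ge0.
have T0 : 0 <= tpow' k s (u x) * G `^ p * psi.
  by rewrite mulr_ge0// mulr_ge0 ?powR_ge0// tpow'_ge0.
rewrite [(_ + _) * (_ * psi)]mulrDl.
case: ifPn => [|_]; last by lra.
rewrite inE => -[xr _].
have [ax0 _] := abx (le_trans R01 (le_trans rR xr)).
have [uk|ku] := leP (u x) k.
  rewrite (tpow_eq0 s uk) !mul0r addr0 /Y (tpow_eq0 s uk) !mulr0 mul0r addr0.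
  by rewrite !addr_ge0// !mulr_ge0 ?powR_ge0.
have ux0 : 0 < u x by exact: lt_trans ku.
have HU : 0 <= tpow k s (u x) <= u x `^ s by rewrite H0 tpow_le.
have psi01 : 0 <= psi <= 1 by rewrite psi0.
have := HK (a x) G (u x) (tpow k s (u x)) (tpow' k s (u x)) psi r ax0 G0 ux0 HU
  (tpow_le_tpow' s k0 (u x)) psi01 r0.
rewrite -/t -/(Y x); lra.
Qed.

Lemma no_solution_gradient theta : p - 1 <= theta -> theta < alpha ->
  (limf_esup (fun r : R => (r `^ (alpha / (theta - alpha)))%:E *
     \int[mu]_(x in annulus r)
       ((a x `^ (theta / (p - 1) - 1) * b x) `^ ((p - 1) / (theta - alpha)))%:E)
     (pinfty_nbhs R) < +oo)%E -> False.
Proof.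
move=> pth tha lim.
have p1' := p1; have q0' := q0.
pose t := (alpha - theta) / alpha.
pose s := q * (theta - p + 1) / (alpha - theta).
have th0 : 0 < theta by lra.
have al0' : 0 < alpha by lra.
have t01 : 0 < t < 1.
  apply/andP; split; first by rewrite divr_gt0 ?subr_gt0.
  by rewrite ltr_pdivrMr// mul1r gtrBl.
have s0 : 0 <= s by rewrite divr_ge0 ?mulr_ge0//; lra.
have [m m1 mt] := exists_inv_le (proj1 (andP t01)).
have m0 : (0 < m)%N by exact: ltnW.
have [C C0 HC] := @cutoff_gradient R n m m0.
have K0 : 0 <= C * c `^ (- ((theta - p + 1) / alpha)).
  by rewrite mulr_ge0 ?powR_ge0.
have HK := pointwise_gradient_term p1 c0 C0 m1 (q := q) pth tha mt.
have mw : lebesgue_measurable_fun (fun x =>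
    (a x `^ (theta / (p - 1) - 1) * b x) `^ ((p - 1) / (theta - alpha))).
  apply: (measurableT_comp (@measurable_powR R _)).
  apply: measurable_funM; last by case: bL.
  by apply: (measurableT_comp (@measurable_powR R _)); case: aL.
have [M [R1 [R10 R01 XM]]] := scaled_limsup mw (fun x => powR_ge0 _ _) lim.
have [R2 R02 uR2] := large_u.
pose Y x := (c * a x * u x `^ q + b x * enorm (gradient u x) `^ alpha) *
  tpow k s (u x).
apply: (@nonexistence_core R n p alpha a b f u k s R1 R2
  (C * c `^ (- ((theta - p + 1) / alpha))) t M C m Y
  (fun r x => r `^ (alpha / (theta - alpha)) *
    (a x `^ (theta / (p - 1) - 1) * b x) `^ ((p - 1) / (theta - alpha)))
  n0 p1 al0 aL bL cf usol k0 s0 m0 R10 t01 K0 HC _ _ _ _ _ XM).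
- have h1 := Linfty_locM (Linfty_locM (Linfty_loc_cst c) aL) Linfty_loc_u.
  have h2 := Linfty_loc_continuous (continuous_enorm_gradient uC).
  have h3 := Linfty_loc_powR (fun x => enorm_ge0 (gradient u x)) al0 h2.
  exact: (Linfty_locM (Linfty_locD h1 (Linfty_locM bL h3)) (Linfty_loc_tpow s)).
- apply: filterS2 a0 b0 => x ax bx; apply: mulr_ge0; last exact: tpow_ge0.
  apply: addr_ge0; last by rewrite mulr_ge0 ?powR_ge0.
  by rewrite mulr_ge0 ?powR_ge0// mulr_ge0// ltW.
- apply: (filterS _ ab0) => x h xR; have [ax bx] := h (le_trans R02 xR).
  have ux := uR2 x xR.
  apply: mulr_gt0; last exact: tpow_gt0.
  apply: ltr_wpDr; first by rewrite mulr_ge0 ?powR_ge0// ltW.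
  by rewrite !mulr_gt0// powR_gt0// (lt_trans k0).
- by move=> r x; rewrite mulr_ge0 ?powR_ge0.
- move=> r; apply: measurable_funM; last exact: mw.
  exact: measurable_cst.
move=> r rR; have r0 : 0 < r by exact: lt_le_trans rR.
apply: filterS3 a0 b0 ab0 => x ax bx abx /=.
have /andP[psi0 psi1] := cutoff01 m r x.
set psi := cutoff m r x in psi0 psi1 *.
have G0 := enorm_ge0 (gradient u x).
have H0 := tpow_ge0 k s (u x).
have src := source_ge s ax psi0.
set G := enorm _ in G0 *.
have YE : Y x * psi = c * a x * u x `^ q * tpow k s (u x) * psi +
    b x * G `^ alpha * (tpow k s (u x) * psi).
  by rewrite /Y -/G; ring.
have T0 : 0 <= tpow' k s (u x) * G `^ p * psi.
  by rewrite mulr_ge0// mulr_ge0 ?powR_ge0// tpow'_ge0.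
have Yle : Y x * psi <= tpow' k s (u x) * G `^ p * psi +
    (a x * f (u x) + b x * G `^ alpha) * (tpow k s (u x) * psi).
  rewrite YE [(_ + _) * (_ * psi)]mulrDl; lra.
apply: lerD => //; case: ifPn => // xA.
move: xA; rewrite inE => -[xr _].
have [ax0 bx0] := abx (le_trans R01 (le_trans rR xr)).
have [uk|ku] := leP (u x) k.
  by rewrite (tpow_eq0 s uk) !mul0r !mulr_ge0 ?powR_ge0.
have ux0 : 0 < u x by exact: lt_trans ku.
have HU : 0 <= tpow k s (u x) <= u x `^ s by rewrite H0 tpow_le.
have psi01 : 0 <= psi <= 1 by rewrite psi0.
exact: (HK (a x) (b x) G (u x) (tpow k s (u x)) psi r ax0 bx0 G0 ux0 HU psi01 r0).
Qed.

End cases.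

Unset Implicit Arguments.

Theorem theorem1p2 (R : realType) (N : nat) (p alpha : R)
    (a b : 'rV[R]_N -> R) (f : R -> R) (R0 : R) :
  (1 <= N)%N -> 1 < p -> 0 <= alpha ->
  Linfty_loc a -> Linfty_loc b ->
  {ae lebesgue_rV N, forall x : 'rV[R]_N, 0 <= a x} ->
  {ae lebesgue_rV N, forall x : 'rV[R]_N, 0 <= b x} ->
  {within `[0, +oo[, continuous f} ->
  (forall t, 0 <= t -> 0 <= f t) ->
  (forall t, 0 < t -> 0 < f t) ->
  0 < R0 ->
  {ae lebesgue_rV N, forall x : 'rV[R]_N,
     R0 <= enorm x -> 0 < a x /\ 0 < b x} ->
  (* (i) *)
  (exists q : R,
    [/\ p - 1 < q,
        (0 < limf_einf (fun t : R => (f t / t `^ q)%:E) (pinfty_nbhs R))%E &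
        (* (i_1) *)
        (exists theta : R,
          [/\ p - 1 < theta, theta < q &
              (limf_esup (fun r : R =>
                 (r `^ (p * q / (theta - q)))%:E *
                 \int[lebesgue_rV N]_(x in annulus r) (a x `^ (theta / (theta - q)))%:E)
                 (pinfty_nbhs R) < +oo)%E])
        \/
        (* (i_2) *)
        (p - 1 < alpha /\
         (limf_esup (fun r : R =>
            (r `^ (alpha / (p - 1 - alpha)))%:E *
            \int[lebesgue_rV N]_(x in annulus r) (b x `^ ((p - 1) / (p - 1 - alpha)))%:E)
            (pinfty_nbhs R) < +oo)%E)])
  \/
  (* (ii) *)
  (exists q : R,
    [/\ 0 < q,
        (0 < limf_einf (fun t : R => (f t / t `^ q)%:E) (pinfty_nbhs R))%E,
        p - 1 < alpha &
        exists theta : R,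
          [/\ p - 1 < theta, theta < alpha &
              (limf_esup (fun r : R =>
                 (r `^ (alpha / (theta - alpha)))%:E *
                 \int[lebesgue_rV N]_(x in annulus r) 
                   ((a x `^ (theta / (p - 1) - 1) * b x)
                      `^ ((p - 1) / (theta - alpha)))%:E)
                 (pinfty_nbhs R) < +oo)%E]]) ->
  ~ exists u : 'rV[R]_N -> R, large_solution p alpha a b f u.
Proof.
move=> N1 p1 al0 aL bL a0 b0 cf f0 _ R00 ab0 cases [u usol].
have growth q : 0 < q ->
    (0 < limf_einf (fun t : R => (f t / t `^ q)%:E) (pinfty_nbhs R))%E ->
    exists c k : R, [/\ 0 < c, 0 < k & forall t, k <= t -> c * t `^ q <= f t].
  move=> q0 /limf_einf_pinfty_gt0[c [k [c0 k0 H]]]; exists c, k; split=> // t kt.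
  rewrite -ler_pdivlMr; first exact: H.
  by rewrite powR_gt0// (lt_le_trans k0).
case: cases => [[q [pq lim c12]]|[q [q0 lim pal [theta [pth tha lim']]]]].
- have q0 : 0 < q by lra.
  have [c [k [c0 k0 fq]]] := growth q q0 lim.
  case: c12 => [[theta [pth thq lim']]|[pal lim']].
    exact: (no_solution_source N1 p1 al0 aL bL a0 b0 cf ab0 usol q0 c0 k0 fq
      pth thq lim').
  (* For theta = p - 1 the exponent of a is 0, and a^0 = 1 even where a vanishes, so the integrand
     of (i_2) is the general one. *)
  have bE : b = fun x => a x `^ ((p - 1) / (p - 1) - 1) * b x.
    apply/funext => x.
    by rewrite divff ?subrr ?powRr0 ?mul1r// gt_eqF// subr_gt0.
  rewrite bE in lim'.
  exact: (no_solution_gradient N1 p1 al0 aL bL a0 b0 cf ab0 usol q0 c0 k0 fq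
      (lexx (p - 1)) pal lim').
- have [c [k [c0 k0 fq]]] := growth q q0 lim.
  exact: (no_solution_gradient N1 p1 al0 aL bL a0 b0 cf ab0 usol q0 c0 k0 fq
    (ltW pth) tha lim').
Qed.
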